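(* Let $\alpha$ be a complex number with $\mathrm{Re}(\alpha)>0$, and let $$C_N(\alpha,T)=\int_{\Omega_N}|a_N|^{\alpha-1}P(T)\,dV .$$ Then the following identities of polynomials in $T$ hold. If $N=2m+1$ (with $m\ge0$), then $$C_{N}(\alpha,T) = D_N \left(\prod_{k=0}^{m} \frac{1 + 2k}{\alpha + 2k}\right) \sum_{i=0}^{m} \frac{2i+1}{2m+1}\, \frac{m!^2}{(2m)!} \binom{2i}{i} \binom{2m-2i}{m-i} T^{2i+1}.$$ If $N=2m$ (with $m\ge1$), then $$C_{N}(\alpha,T) = D_N \left( \prod_{k=0}^{m-1} \frac{1 + 2k}{\alpha + 2k} \right) \sum_{i=0}^{m} \frac{2i + \alpha}{2m + \alpha }\, \frac{m!^2}{(2m)!} \binom{2i}{i} \binom{2m-2i}{m-i} T^{2i}.$$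
   Context: Identify a monic real polynomial $P(x)=x^N+a_1x^{N-1}+\cdots+a_N$ with $(a_1,\dots,a_N)\in\mathbf{R}^N$; $\Omega_N\subset\mathbf{R}^N$ is the region of monic real polynomials of degree $N$ all of whose complex roots have absolute value at most $1$, and $dV$ is Lebesgue measure. In the integral, $P$ is the polynomial corresponding to the point of integration and $a_N=P(0)$ is its constant coefficient. The constants $D_N$ are $$D_{N} = \prod_{k=0}^{m-1} \left(\frac{k!^2 2^{2k+1}}{(2k+1)!}\right)^2 \ (N = 2m),\qquad D_{N} = \left(\frac{m!^2 2^{2m+1}}{(2m+1)!}\right) \prod_{k=0}^{m-1} \left(\frac{k!^2 2^{2k+1}}{(2k+1)!}\right)^2\ (N = 2m+1).$$ *)

(* Defs.v *)
From HB Require Import structures.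
From mathcomp Require Import all_boot all_order all_algebra.
From mathcomp Require Import all_classical all_reals all_analysis.
From mathcomp Require Import complex.

Set Implicit Arguments.
Unset Strict Implicit.
Unset Printing Implicit Defensive.

Import Order.TTheory GRing.Theory Num.Theory.
Import numFieldNormedType.Exports.

Local Open Scope classical_set_scope.
Local Open Scope ring_scope.
Local Open Scope complex_scope.

(* R^n, with the product of the Borel sigma-algebras of R *)
Notation Rn R n := (n.-tuple (measurableTypeR R)).

Section lebesgue_measure_n.
Variable R : realType.

Definition ncons n (p : measurableTypeR R * Rn R n) : Rn R n.+1 :=
  [the Rn R n.+1 of p.1 :: p.2].

Lemma measurable_ncons n : measurable_fun [set: _] (@ncons n).
Proof. exact: measurable_cons measurable_fst measurable_snd. Qed.

(* Lebesgue measure on R^n: the n-fold product of lebesgue_measure, with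
   R^(n+1) identified with R * R^n; see lebesgue_measure_n_box *)
Fixpoint lebesgue_measure_n n : set (Rn R n) -> \bar R :=
  match n with
  | 0 => dirac ([tuple] : Rn R 0)
  | m.+1 => pushforward (lebesgue_measure \x lebesgue_measure_n (n := m))%E
                        (@ncons m)
  end.

Section step.
Variables (n : nat) (mu : {sigma_finite_measure set (Rn R n) -> \bar R}).

Definition push := pushforward (lebesgue_measure \x mu)%E (@ncons n).

Let push0 : push set0 = 0%E.
Proof. by rewrite /push /pushforward preimage_set0 measure0. Qed.

Let push_ge0 A : (0 <= push A)%E.
Proof. by rewrite /push /pushforward; exact: measure_ge0. Qed.

Let push_sigma_additive : semi_sigma_additive push.
Proof.
have mp A : measurable A -> measurable (@ncons n @^-1` A).
  by move=> mA; rewrite -[X in measurable X]setTI; exact: measurable_ncons.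
move=> F mF tF mUF; rewrite /push /pushforward preimage_bigcup.
apply: measure_semi_sigma_additive.
- by move=> k; exact: mp.
- apply/trivIsetP => /= i j _ _ ij; rewrite -preimage_setI.
  by move/trivIsetP : tF => /(_ _ _ _ _ ij) ->//; rewrite preimage_set0.
- by rewrite -preimage_bigcup; exact: mp.
Qed.

HB.instance Definition _ := isMeasure.Build _ _ _ push
  push0 push_ge0 push_sigma_additive.

Let push_sigma_finite : sigma_finite setT push.
Proof.
have /sigma_finiteP[F [TF ndF Foo]] := sigma_finiteT (@lebesgue_measure R).
have /sigma_finiteP[G [TG ndG Goo]] := sigma_finiteT mu.
pose uncons (t : Rn R n.+1) : measurableTypeR R * Rn R n :=
  (thead t, [tuple of behead t]).
have unconsK : cancel (@ncons n) uncons.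
  by move=> [x t]; congr pair; apply: val_inj.
have muncons : measurable_fun [set: _] uncons.
  apply/measurable_fun_pairP; split.
    exact: (measurable_tnth ord0).
  exact: measurable_behead.
exists (fun k => uncons @^-1` (F k `*` G k)).
  apply/esym; rewrite -subTset => t _.
  have [k _ Fk] : (\bigcup_k F k) (thead t) by rewrite -TF.
  have [l _ Gl] : (\bigcup_l G l) [tuple of behead t] by rewrite -TG.
  exists (maxn k l) => //; split => /=.
    by move: Fk; exact/subsetPset/ndF/leq_maxl.
  by move: Gl; exact/subsetPset/ndG/leq_maxr.
move=> k; have [mF Fk] := Foo k; have [mG Gk] := Goo k; split.
  by rewrite -[X in measurable X]setTI; apply: muncons => //; exact: measurableX.
rewrite /push /pushforward -comp_preimage.
rewrite (_ : uncons \o _ = id); last by apply/funext => x /=; rewrite unconsK.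
by rewrite preimage_id product_measure1E// lte_mul_pinfty// ge0_fin_numE.
Qed.

HB.instance Definition _ := Measure_isSigmaFinite.Build _ _ _ push
  push_sigma_finite.

Definition lebesgue_measure_step
  : {sigma_finite_measure set (Rn R n.+1) -> \bar R} := push.

End step.

Lemma lebesgue_measure_n_structure n :
  exists mu : {sigma_finite_measure set (Rn R n) -> \bar R},
     @lebesgue_measure_n n = mu.
Proof.
elim: n => [|n [mu IH]].
  by exists (dirac ([tuple] : Rn R 0)).
exists (lebesgue_measure_step mu) => /=.
by rewrite IH.
Qed.

Let lebn0 n : @lebesgue_measure_n n set0 = 0%E.
Proof. by have [mu ->] := lebesgue_measure_n_structure n; rewrite measure0. Qed.

Let lebn_ge0 n A : (0 <= @lebesgue_measure_n n A)%E.
Proof. by have [mu ->] := lebesgue_measure_n_structure n. Qed.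

Let lebn_sigma_additive n : semi_sigma_additive (@lebesgue_measure_n n).
Proof.
have [mu ->] := lebesgue_measure_n_structure n.
exact: measure_semi_sigma_additive.
Qed.

HB.instance Definition _ n := isMeasure.Build _ _ _ (@lebesgue_measure_n n)
  (@lebn0 n) (@lebn_ge0 n) (@lebn_sigma_additive n).

Let lebn_sigma_finite n : sigma_finite setT (@lebesgue_measure_n n).
Proof.
by have [mu ->] := lebesgue_measure_n_structure n; exact: sigma_finiteT.
Qed.

HB.instance Definition _ n := Measure_isSigmaFinite.Build _ _ _
  (@lebesgue_measure_n n) (@lebn_sigma_finite n).

Lemma lebesgue_measure_n_box n (A : 'I_n -> set (measurableTypeR R)) :
  (forall i, measurable (A i)) ->
  lebesgue_measure_n [set t : Rn R n | forall i, A i (tnth t i)] =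
  (\prod_(i < n) lebesgue_measure (A i))%E.
Proof.
elim: n A => [|n IH] A mA.
  rewrite big_ord0 /= diracE mem_set// => -[].
  by case.
rewrite big_ord_recl -IH// /= /pushforward.
rewrite -product_measure1E//; last first.
  rewrite [X in measurable X](_ : _ =
    \bigcap_(i in [set: 'I_n]) ((fun t : Rn R n => tnth t i) @^-1` A (lift ord0 i))).
    apply: fin_bigcap_measurable => // i _.
    by rewrite -[X in measurable X]setTI; exact: measurable_tnth.
  by apply/seteqP; split => [t h i _|t h i]; [exact: h|exact: (h i)].
congr (product_measure1 _ _ _); apply/seteqP; split => [[x t] /= h|[x t] /= [hx h] i].
  split; first exact: (h ord0).
  by move=> i; have := h (lift ord0 i); rewrite tnthS.
by case: (unliftP ord0 i) => [j ->|->//]; rewrite tnthS; exact: h.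
Qed.

End lebesgue_measure_n.

Section complex_integral.
Context d (T : measurableType d) (R : realType)
  (mu : {measure set T -> \bar R}).
Implicit Types (D : set T) (f : T -> R[i]).

(* the integral is total, with a junk value when f is not integrable *)
Definition Cintegrable D f :=
  mu.-integrable D (fun x => (complex.Re (f x))%:E) /\
  mu.-integrable D (fun x => (complex.Im (f x))%:E).

Definition Cintegral D f : R[i] :=
  Rintegral mu D (fun x => complex.Re (f x)) +i*
  Rintegral mu D (fun x => complex.Im (f x)).

End complex_integral.

Section definitions.
Variable R : realType.

Definition cexp (z : R[i]) : R[i] :=
  (expR (complex.Re z))%:C * (cos (complex.Im z) +i* sin (complex.Im z)).

(* principal value of x ^ z for real x >= 0, with 0 ^ z := 0 for z != 0 and
   0 ^ 0 := 1 *)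
Definition cpow (x : R) (z : R[i]) : R[i] :=
  if x == 0 then (z == 0)%:R else cexp (z * (ln x)%:C).

(* x^N + a_1 x^(N-1) + ... + a_N; tnth a k is the coefficient a_(k+1) *)
Definition monic_poly N (a : Rn R N) : {poly R} :=
  'X^N + \sum_(k < N) (tnth a k : R) *: 'X^(N - k.+1).

Definition complex_poly N (a : Rn R N) : {poly R[i]} :=
  map_poly (real_complex R) (monic_poly a).

Definition Omega N : set (Rn R N) :=
  [set a | forall z : R[i], root (complex_poly a) z -> `|z| <= 1].

(* |a_N|^(alpha-1) P(T), where a_N = P(0) *)
Definition integrand N (alpha T : R[i]) (a : Rn R N) : R[i] :=
  cpow `|(monic_poly a).[0]| (alpha - 1) * (complex_poly a).[T].

Definition CN N (alpha T : R[i]) : R[i] :=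
  Cintegral (@lebesgue_measure_n R N) (@Omega N) (integrand alpha T).

Definition Dfactor (k : nat) : R :=
  k`!%:R ^+ 2 * 2 ^+ (2 * k + 1) / (2 * k + 1)`!%:R.

(* N./2 is the m of N = 2m and of N = 2m + 1 *)
Definition DN (N : nat) : R :=
  (if odd N then Dfactor N./2 else 1) * \prod_(k < N./2) Dfactor k ^+ 2.

End definitions.

(* Main.v *)
(* Schur's recursion: for |k| < 1, a monic polynomial with constant coefficient k
   has all its roots in the closed unit disc iff it is P = x Q + k Q^*, where Q is
   monic of degree one less with all its roots in the disc and Q^* is the reversed
   polynomial; indeed |Q^*(z)| <= |Q(z)| for |z| >= 1.  In the coefficients, this is
   q_j |-> q_j + k q_(n+1-j), which is a product of 2x2 blocks [[1, k], [k, 1]], of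
   determinant (1 - k^2)^m for n = 2m, and (1 - k^2)^m (1 + k) for n = 2m + 1.  Since
   |k| = 1 is negligible, integrating over k last expresses the integral of
   |a_N|^(alpha-1) a_j over Omega_N by the two moments of q_j and q_(n+1-j) over
   Omega_n and by the beta integrals of |k|^(alpha-1) (1 - k^2)^m over ]-1, 1[.  The
   case alpha = 1 gives the moments by induction, and the sum of the two terms that
   arise for even N is the recursion for central binomial coefficients. *)
Require Import Defs.
From HB Require Import structures.
From mathcomp Require Import all_boot all_order all_algebra.
From mathcomp Require Import all_classical all_reals all_analysis.
From mathcomp Require Import measurable_realfun complex.
From mathcomp Require Import ring lra zify.

Set Implicit Arguments.
Unset Strict Implicit.
Unset Printing Implicit Defensive.

Import Order.TTheory GRing.Theory Num.Theory.

Local Open Scope ring_scope.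
Local Open Scope complex_scope.

(** * Lebesgue measure on tuples *)

(** For a fixed k in ]-1, 1[ the fibre of Omega is the image of the region one degree lower, which
    does not depend on k; only the Jacobian and the weight see k. The Jacobian is obtained without a
    determinant theorem: the coefficient map is assembled from one-coordinate affine maps, each
    handled by affine substitution on the line and Tonelli. The weight |k|^(alpha-1) is unbounded
    near 0 if Re alpha < 1 and oscillates if alpha is not real. So the change of variables is first
    proved for nonnegative functions with values in [0, +oo]; integrability of the signed integrands
    is read off from it, and finiteness of the moments is carried along the same induction. The real
    and imaginary parts of the weight are two instances of one recursion with a real weight. Parity
    in k shapes the closed forms: on ]-1, 1[ only even functions of k survive, and multiplying the
    weight by k^2 replaces alpha by alpha + 2. *)

Lemma pushforward_measure d d' (X : measurableType d) (Y : measurableType d')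
    (R : realType) (mu : {measure set X -> \bar R}) (phi : X -> Y) :
    measurable_fun setT phi ->
  exists nu : {measure set Y -> \bar R}, nu = pushforward mu phi :> (set Y -> _).
Proof.
by move=> mphi; exists (measure_function_pushforward__canonical__measure_function_Measure mu mphi).
Qed.

Section tonelli_tuples.
Variable R : realType.
Local Open Scope classical_set_scope.
Local Notation leb := (@lebesgue_measure R).
Local Open Scope ereal_scope.

(** The pushforward of Lebesgue measure under x -> c x + b, scaled by c, agrees with Lebesgue
    measure on half-open intervals, hence everywhere by uniqueness. *)
Lemma ge0_integral_affine (c b : R) (f : measurableTypeR R -> \bar R) : (0 < c)%R ->
  measurable_fun [set: measurableTypeR R] f -> (forall x, 0 <= f x) ->
  c%:E * \int[leb]_x f (c * x + b)%R = \int[leb]_x f x.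
Proof.
move=> c0 mf f0; pose g (x : measurableTypeR R) : measurableTypeR R := (c * x + b)%R.
have mg : measurable_fun setT g by exact: measurable_funD.
have c0' : (0 <= c)%R by exact: ltW.
have [gleb glebE] := pushforward_measure leb mg.
pose nu := mscale (NngNum c0') gleb.
transitivity (\int[nu]_x f x).
  rewrite ge0_integral_mscale//=; congr (_ * _).
  by rewrite glebE (ge0_integral_pushforward mg).
apply/esym/eq_measure_integral => A mA _; rewrite -[RHS]/(nu A).
apply: lebesgue_measure_unique mA => _ [[x y] _ <-] /=.
rewrite /nu /mscale /= glebE /pushforward.
rewrite (_ : _ @^-1` _ = [set` `](x - b) / c, (y - b) / c]%R]); last first.
  apply/seteqP; split=> z; rewrite /g /= !in_itv/= ltr_pdivrMr// ler_pdivlMr//;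
    by rewrite ltrBlDr lerBrDr mulrC.
have E : leb [set` `](x - b) / c, (y - b) / c]%R] = _ := lebesgue_measure_itv _.
rewrite lebesgue_measure_itv [X in _ = _ * X]E/=.
rewrite !lte_fin ltr_pM2r ?invr_gt0// ltrD2r.
case: ifP => _; last by rewrite mule0.
by rewrite -!EFinB -EFinM; congr (_ %:E); field; rewrite gt_eqF.
Qed.

Local Notation lebn n := (@lebesgue_measure_n R n).

Lemma ge0_integral_ncons n (f : Rn R n.+1 -> \bar R) :
  measurable_fun setT f -> (forall t, 0 <= f t) ->
  \int[lebn n.+1]_t f t = \int[leb]_x \int[lebn n]_t f (Defs.ncons (x, t)).
Proof.
move=> mf f0; rewrite /= (ge0_integral_pushforward (@measurable_ncons R n))//.
rewrite preimage_setT fubini_tonelli1//.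
  by apply: measurableT_comp mf _; exact: measurable_ncons.
by move=> p; exact: f0.
Qed.

Lemma measurable_fun_tuple d (T : measurableType d) n (F : 'I_n -> T -> R) :
  (forall i, measurable_fun setT (F i : T -> measurableTypeR R)) ->
  measurable_fun setT (fun x => [tuple F i x | i < n] : Rn R n).
Proof.
move=> mF; apply/measurable_fun_tnthP => i.
by rewrite (_ : _ \o _ = F i)//; apply/funext => x /=; rewrite tnth_mktuple.
Qed.

Lemma measurable_coord n (i : 'I_n) :
  measurable_fun setT (fun t : Rn R n => tnth t i).
Proof. exact: measurable_tnth. Qed.

Definition nrcons n (p : measurableTypeR R * Rn R n) : Rn R n.+1 :=
  [tuple of rcons p.2 p.1].

Lemma tnth_nrcons_widen n p (i : 'I_n) (j : 'I_n.+1) :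
  i = j :> nat -> tnth (nrcons p) j = tnth p.2 i.
Proof.
move=> ij; rewrite !(tnth_nth 0%R)/= nth_rcons size_tuple -ij ltn_ord.
by [].
Qed.

Lemma tnth_nrcons_max n (p : measurableTypeR R * Rn R n) :
  tnth (nrcons p) ord_max = p.1.
Proof. by rewrite (tnth_nth 0%R)/= nth_rcons size_tuple ltnn eqxx. Qed.

Lemma measurable_nrcons n : measurable_fun setT (@nrcons n).
Proof.
apply/measurable_fun_tnthP => i.
have [ilt|ige] := ltnP i n.
  rewrite (_ : _ \o _ = (fun t => tnth t (Ordinal ilt)) \o snd).
    by apply: measurableT_comp; [exact: measurable_coord|exact: measurable_snd].
  by apply/funext => p /=; rewrite (@tnth_nrcons_widen _ _ (Ordinal ilt)).
rewrite (_ : _ \o _ = fst); first exact: measurable_fst.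
apply/funext => p /=; rewrite -[RHS]tnth_nrcons_max; congr (tnth _ _).
by apply: val_inj => /=; have := ltn_ord i; lia.
Qed.

Lemma nrcons_ncons n (x k : measurableTypeR R) (t : Rn R n) :
  nrcons (k, Defs.ncons (x, t)) = Defs.ncons (x, nrcons (k, t)).
Proof. exact: val_inj. Qed.

Lemma measurable_pairl d1 d2 (X : measurableType d1) (Y : measurableType d2)
  (x : X) : measurable_fun setT (fun y : Y => (x, y)).
Proof. exact: measurable_fun_pair. Qed.

(** The measure is built by prepending coordinates, whereas Schur's parameter is the last
    coefficient. By induction Tonelli moves the last variable outwards past each earlier one. *)
Lemma ge0_integral_nrcons n (f : Rn R n.+1 -> \bar R) :
  measurable_fun setT f -> (forall t, 0 <= f t) ->
  \int[lebn n.+1]_t f t = \int[leb]_k \int[lebn n]_t f (nrcons (k, t)).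
Proof.
elim: n f => [|n IH] f mf f0.
  rewrite ge0_integral_ncons//; apply: eq_integral => x _.
  by apply: eq_integral => t _; congr f; apply: val_inj; rewrite (tuple0 t).
rewrite ge0_integral_ncons//.
transitivity (\int[leb]_x \int[leb]_k \int[lebn n]_t f (Defs.ncons (x, nrcons (k, t)))).
  apply: eq_integral => x _; rewrite IH//.
  exact: (measurableT_comp mf (measurableT_comp (@measurable_ncons R _)
    (@measurable_pairl _ _ _ _ _))).
rewrite (fubini_tonelli (fun p => \int[lebn n]_t f (Defs.ncons (p.1, nrcons (p.2, t)))))/=.
- apply: eq_integral => k _; rewrite ge0_integral_ncons//.
    by apply: eq_integral => x _; apply: eq_integral => t _; rewrite nrcons_ncons.
  exact: (measurableT_comp mf (measurableT_comp (@measurable_nrcons _)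
    (@measurable_pairl _ _ _ _ _))).
- pose g p := f (Defs.ncons (p.1.1, nrcons (p.1.2, p.2))).
  apply: (measurable_fun_fubini_tonelli_F g); last by move=> ?; exact: f0.
  apply: (measurableT_comp mf (measurableT_comp (@measurable_ncons R _) _)).
  apply/measurable_fun_pairP; split => /=.
    exact: (measurableT_comp measurable_fst measurable_fst).
  apply: (measurableT_comp (@measurable_nrcons _)).
  apply/measurable_fun_pairP; split => /=; last exact: measurable_snd.
  exact: (measurableT_comp measurable_snd measurable_fst).
- by move=> p; apply: integral_ge0.
Qed.

Definition set_coord n (t : Rn R n) (j : 'I_n) (x : R) : Rn R n :=
  [tuple if i == j then x else tnth t i | i < n].

Lemma measurable_set_coord n (j : 'I_n) (h : Rn R n -> measurableTypeR R) :
  measurable_fun setT h -> measurable_fun setT (fun t => set_coord t j (h t)).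
Proof.
move=> mh; apply: measurable_fun_tuple => i.
by case: eqP => _ //; exact: measurable_coord.
Qed.

Lemma tnth_ncons0 n x (t : Rn R n) : tnth (Defs.ncons (x, t)) ord0 = x.
Proof. by []. Qed.

Lemma tnth_nconsS n x (t : Rn R n) i :
  tnth (Defs.ncons (x, t)) (lift ord0 i) = tnth t i.
Proof. exact: tnthS. Qed.

Lemma set_coord_ncons0 n x (t : Rn R n) y :
  set_coord (Defs.ncons (x, t)) ord0 y = Defs.ncons (y, t).
Proof.
apply: eq_from_tnth => i; rewrite tnth_mktuple.
by case: (unliftP ord0 i) => [k ->|->]; rewrite ?tnth_nconsS// eqxx.
Qed.

Lemma set_coord_nconsS n x (t : Rn R n) j y :
  set_coord (Defs.ncons (x, t)) (lift ord0 j) y = Defs.ncons (x, set_coord t j y).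
Proof.
apply: eq_from_tnth => i; rewrite tnth_mktuple.
case: (unliftP ord0 i) => [k ->|->] //.
by rewrite !tnth_nconsS tnth_mktuple (inj_eq lift_inj).
Qed.

(** An affine change of one coordinate whose shift depends only on the others has Jacobian c.
    Leading coordinates are peeled off until j is the first; Tonelli then makes it the inner
    variable, where the one-dimensional substitution applies. *)
Lemma ge0_integral_set_coord n (j : 'I_n) (c : R)
    (l : Rn R n -> measurableTypeR R) (f : Rn R n -> \bar R) :
  (0 < c)%R -> measurable_fun setT l ->
  (forall t x, l (set_coord t j x) = l t) ->
  measurable_fun setT f -> (forall t, 0 <= f t) ->
  c%:E * \int[lebn n]_t f (set_coord t j (c * tnth t j + l t)%R) =
  \int[lebn n]_t f t.
Proof.
move=> c0; elim: n j l f => [[]//|n IH] j l f ml lj mf f0.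
pose g t := f (set_coord t j (c * tnth t j + l t)%R).
have g0 t : 0 <= g t by exact: f0.
have mF : measurable_fun setT g.
  apply: (measurableT_comp mf); apply: measurable_set_coord.
  apply: measurable_funD => //; apply: measurable_funM => //.
  exact: measurable_coord.
rewrite -[\int[_]_t f (set_coord _ _ _)]/(\int[lebn n.+1]_t g t).
have mf2 (h : Rn R n.+1 -> \bar R) : measurable_fun setT h ->
    measurable_fun setT (fun p => h (@Defs.ncons R n (p.1, p.2))).
  move=> mh; apply: measurableT_comp mh _.
  rewrite (_ : (fun _ => _) = @Defs.ncons R n); first exact: measurable_ncons.
  by apply/funext => -[].
rewrite !ge0_integral_ncons//.
have [j' jE|jE] := unliftP ord0 j.
- rewrite -ge0_integralZl//; last 3 first.
  + exact: (measurable_fun_fubini_tonelli_F (fun p => g (Defs.ncons (p.1, p.2))) (mf2 _ mF) (fun=> g0 _)).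
  + by move=> x _; apply: integral_ge0.
  + by rewrite lee_fin ltW.
  apply: eq_integral => x _.
  rewrite -[RHS](IH j' (fun t => l (Defs.ncons (x, t))))//; last 3 first.
  + exact: (measurableT_comp ml (measurableT_comp (@measurable_ncons R _)
      (@measurable_pairl _ _ _ _ _))).
  + by move=> t y; rewrite -set_coord_nconsS -jE lj.
  + exact: (measurableT_comp mf (measurableT_comp (@measurable_ncons R _)
      (@measurable_pairl _ _ _ _ _))).
  congr (_ * _); apply: eq_integral => t _.
  by rewrite /g jE set_coord_nconsS tnth_nconsS.
- rewrite (fubini_tonelli (fun p => g (Defs.ncons (p.1, p.2))) (mf2 _ mF))//.
  rewrite (fubini_tonelli (fun p => f (Defs.ncons (p.1, p.2))) (mf2 _ mf))//=.
  rewrite -ge0_integralZl//; last 3 first.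
  + exact: (measurable_fun_fubini_tonelli_G (fun p => g (Defs.ncons (p.1, p.2))) (mf2 _ mF) (fun=> g0 _)).
  + by move=> x _; apply: integral_ge0.
  + by rewrite lee_fin ltW.
  apply: eq_integral => t _.
  (* By [lj] the shift ignores the first coordinate, so its value at 0 serves as the constant of the
     affine map. *)
  rewrite -[RHS](@ge0_integral_affine c (l (Defs.ncons (0%R, t))) (fun x => f (Defs.ncons (x, t))) c0)//.
    congr (_ * _); apply: eq_integral => x _.
    rewrite /g jE set_coord_ncons0 tnth_ncons0.
    by rewrite -(lj (Defs.ncons (0%R, t)) x) jE set_coord_ncons0.
  exact: (measurableT_comp mf (measurableT_comp (@measurable_ncons R _)
    (measurable_fun_pair (@measurable_id _ _ _) (measurable_cst _)))).
Qed.

(** This is the step of the Levinson-Durbin recursion; with indices from 0, the reflection j -> n +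
    1 - j becomes [rev_ord]. *)
Definition levinson n (k : R) (t : Rn R n) : Rn R n :=
  [tuple tnth t i + k * tnth t (rev_ord i) | i < n]%R.

Definition levinson_det n (k : R) : R :=
  ((1 - k ^+ 2) ^+ n./2 * (1 + k) ^+ odd n)%R.

(** Only the m outermost blocks are switched on, which allows an induction on the number of
    blocks. *)
Let levinson_upto n (k : R) m (t : Rn R n) : Rn R n :=
  [tuple if (i < m)%N || (rev_ord i < m)%N
         then (tnth t i + k * tnth t (rev_ord i))%R else tnth t i | i < n].

(* The block [[1, k], [k, 1]] as two single-coordinate updates, of determinants 1
   and 1 - k^2. *)
Let pair_update n (k : R) (a : 'I_n) (t : Rn R n) : Rn R n :=
  let s := set_coord t a (1 * tnth t a + k * tnth t (rev_ord a))%R in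
  set_coord s (rev_ord a) ((1 - k ^+ 2) * tnth s (rev_ord a) + k * tnth s a)%R.

Lemma measurable_update n (j : 'I_n) (c : R) (l : Rn R n -> measurableTypeR R) :
  measurable_fun setT l ->
  measurable_fun setT (fun t => set_coord t j (c * tnth t j + l t)%R).
Proof.
move=> ml; apply: measurable_set_coord; apply: measurable_funD => //.
by apply: measurable_funM => //; exact: measurable_coord.
Qed.

Lemma measurable_scaled_coord n (k : R) (i : 'I_n) : measurable_fun setT
  (fun t : Rn R n => (k * tnth t i)%R : measurableTypeR R).
Proof. by apply: measurable_funM => //=; exact: measurable_coord. Qed.

Let measurable_pair_update n (k : R) (a : 'I_n) :
  measurable_fun setT (@pair_update n k a).
Proof.
exact: (measurableT_comp (measurable_update (rev_ord a) _ (measurable_scaled_coord k a))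
  (measurable_update a _ (measurable_scaled_coord k (rev_ord a)))).
Qed.

Let ge0_integral_pair_update n (k : R) (a : 'I_n) (f : Rn R n -> \bar R) :
  (`|k| < 1)%R -> a != rev_ord a ->
  measurable_fun setT f -> (forall t, 0 <= f t) ->
  (1 - k ^+ 2)%:E * \int[lebn n]_t f (pair_update k a t) = \int[lebn n]_t f t.
Proof.
move=> k1 aa mf f0.
have c0 : (0 < 1 - k ^+ 2)%R by rewrite subr_gt0 -real_normK ?num_real// expr_lt1.
rewrite -[RHS](@ge0_integral_set_coord n (rev_ord a) _ _ f c0 (measurable_scaled_coord k a))//; last first.
  by move=> t x; rewrite tnth_mktuple (negbTE aa).
congr (_ * _).
rewrite -[RHS](@ge0_integral_set_coord n a 1 _ _ ltr01 (measurable_scaled_coord k (rev_ord a))).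
- by rewrite mul1e.
- by move=> t x; rewrite tnth_mktuple eq_sym (negbTE aa).
- exact: (measurableT_comp mf (measurable_update _ _ (measurable_scaled_coord k a))).
- by move=> t; exact: f0.
Qed.

Let levinson_uptoS n (k : R) (a : 'I_n) (t : Rn R n) : (a < n./2)%N ->
  levinson_upto k a.+1 t = pair_update k a (levinson_upto k a t).
Proof.
move=> an; apply: eq_from_tnth => i; rewrite !tnth_mktuple.
(* The index a lies strictly to the left of its mirror image, so the two form a genuine block, still
   untouched by the blocks before it. *)
have a2 : (a.*2 < n.-1)%N by have := ltn_ord a; lia.
have aa : (a == rev_ord a) = false.
  by apply/eqP => /(congr1 val) /=; have := ltn_ord a; lia.
have ra : (rev_ord a < a)%N = false by apply/negbTE; rewrite -leqNgt /=; lia.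
rewrite rev_ordK eqxx ltnn ra [rev_ord a == a]eq_sym aa/=.
case: (eqVneq i (rev_ord a)) => [->|ira].
  by rewrite rev_ordK (_ : (_ || _) = true) /=; [ring|lia].
case: (eqVneq i a) => [->|ia]; first by rewrite ltnSn/=; ring.
have ia' : i <> a :> nat by move=> /val_inj/eqP; apply/negP.
have ira' : i <> rev_ord a :> nat by move=> /val_inj/eqP; apply/negP.
by congr (if _ then _ else _); move: ia' ira'; rewrite /=; have := ltn_ord i; lia.
Qed.

Lemma ge0_integral_levinson n (k : R) (f : Rn R n -> \bar R) :
  (`|k| < 1)%R -> measurable_fun setT f -> (forall t, 0 <= f t) ->
  (levinson_det n k)%:E * \int[lebn n]_t f (levinson k t) = \int[lebn n]_t f t.
Proof.
move=> k1.
have c0 : (0 < 1 - k ^+ 2)%R by rewrite subr_gt0 -real_normK ?num_real// expr_lt1.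
have d0 : (0 < 1 + k)%R by move: k1; rewrite ltr_norml => /andP[]; lra.
have upto m (g : Rn R n -> \bar R) : (m <= n./2)%N ->
    measurable_fun setT g -> (forall t, 0 <= g t) ->
    ((1 - k ^+ 2) ^+ m)%:E * \int[lebn n]_t g (levinson_upto k m t) =
    \int[lebn n]_t g t.
  elim: m g => [|m IH] g mn mg g0.
    rewrite expr0 mul1e; apply: eq_integral => t _; congr g.
    by apply: eq_from_tnth => i; rewrite tnth_mktuple.
  have mn' : (m < n)%N by lia.
  pose a := Ordinal mn'.
  rewrite exprS EFinM -muleA -(@ge0_integral_pair_update n k a g)//; last first.
    by apply/eqP => /(congr1 val) /=; lia.
  congr (_ * _); rewrite -[RHS]IH ?(ltnW mn)//.
    congr (_ * _); apply: eq_integral => t _.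
    by rewrite -(levinson_uptoS k (a := a)).
  exact: (measurableT_comp mg (measurable_pair_update _ _)).
move=> mf f0; rewrite /levinson_det.
have [no|ne] := boolP (odd n); last first.
  rewrite expr0 mulr1 -[RHS](upto n./2)//; congr (_ * _).
  apply: eq_integral => t _; congr f; apply: eq_from_tnth => i.
  by rewrite !tnth_mktuple; case: ifPn => //= h; exfalso; have := ltn_ord i; lia.
(* For odd n the middle coordinate is its own mirror image: it is multiplied by 1 + k, an update
   with zero shift. *)
have rn : (n./2 < n)%N by lia.
pose a := Ordinal rn.
rewrite expr1 mulrC EFinM -muleA.
rewrite -[RHS](@ge0_integral_set_coord n a (1 + k) (cst 0%R) f d0)//.
congr (_ * _); rewrite -[RHS](upto n./2)//.
  congr (_ * _); apply: eq_integral => t _; congr f; apply: eq_from_tnth => i.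
  have ra : rev_ord a = a by apply: val_inj => /=; lia.
  rewrite !tnth_mktuple ra ltnn /= addr0.
  case: (eqVneq i a) => [->|ia]; first by rewrite ra; ring.
  have {}ia : i <> a :> nat by move=> /val_inj/eqP; apply/negP.
  by case: ifPn => //= h; exfalso; move: ia; have := ltn_ord i; rewrite /=; lia.
apply: (measurableT_comp mf).
exact: (@measurable_update n a (1 + k)%R (cst 0%R) (measurable_cst _)).
Qed.

End tonelli_tuples.

(** * The Schur-Cohn recursion *)

Section schur_cohn.
Local Open Scope classical_set_scope.
Variable R : realType.
Local Notation C := R[i].

(* a_j, with a_0 = 1 and the default a_j = 0 for j > N *)
Definition acoef N (a : Rn R N) (j : nat) : R := nth 0 (1 :: a) j.

Definition evalp N (a : Rn R N) (z : C) : C :=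
  \sum_(j < N.+1) (acoef a j)%:C * z ^+ (N - j).

Definition evalp_rev N (a : Rn R N) (z : C) : C :=
  \sum_(j < N.+1) (acoef a j)%:C * z ^+ j.

Lemma acoef0 N (a : Rn R N) : acoef a 0 = 1. Proof. by []. Qed.

Lemma acoefS N (a : Rn R N) (i : 'I_N) : acoef a i.+1 = tnth a i.
Proof. by rewrite /acoef /= (tnth_nth 0). Qed.

Lemma acoef_default N (a : Rn R N) j : (N < j)%N -> acoef a j = 0.
Proof. by move=> Nj; rewrite /acoef nth_default//= size_tuple. Qed.

Lemma horner_complex_poly N (a : Rn R N) (z : C) : (complex_poly a).[z] = evalp a z.
Proof.
rewrite /complex_poly /monic_poly rmorphD/= map_polyXn raddf_sum/= hornerD hornerXn.
rewrite horner_sum /evalp big_ord_recl /= acoef0 mul1r subn0; congr (_ + _).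
apply: eq_bigr => i _; rewrite map_polyZ/= map_polyXn hornerZ hornerXn.
by rewrite /bump /= add1n acoefS.
Qed.

Lemma complex_poly_monic N (a : Rn R N) : complex_poly a \is monic /\
  size (complex_poly a) = N.+1.
Proof.
suff [Pm sP] : monic_poly a \is monic /\ size (monic_poly a) = N.+1.
  by rewrite /complex_poly map_monic // size_map_poly.
have sz : (size (\sum_(k < N) (tnth a k : R) *: 'X^(N - k.+1) : {poly R})%R
    < size ('X^N : {poly R})%R)%N.
  rewrite size_polyXn ltnS; apply: leq_trans (size_sum _ _ _) _; apply/bigmax_leqP => i _.
  by rewrite (leq_trans (size_scale_leq _ _))// size_polyXn; have := ltn_ord i; lia.
split; last by rewrite /monic_poly size_polyDl// size_polyXn.
by rewrite monicE /monic_poly lead_coefDl// lead_coefXn.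
Qed.

Lemma complex_poly_roots N (a : Rn R N) : Omega a ->
  exists2 rs : seq C, size rs = N /\ (forall r, r \in rs -> `|r| <= 1) &
    complex_poly a = \prod_(r <- rs) ('X - r%:P).
Proof.
move=> Oa; have [Pm sP] := complex_poly_monic a.
have [rs rsE] := closed_field_poly_normal (complex_poly a).
rewrite (monicP Pm) scale1r in rsE.
exists rs => //; split.
  by apply/eqP; rewrite -eqSS -sP rsE size_prod_XsubC.
by move=> r rrs; apply: Oa; rewrite rsE root_prod_XsubC.
Qed.

Lemma conj_evalp_rev N (a : Rn R N) (z : C) :
  ((evalp_rev a z)^*)%R = evalp_rev a (z^*)%R.
Proof.
rewrite /evalp_rev rmorph_sum /=; apply: eq_bigr => j _.
by rewrite rmorphM rmorphXn/=; congr (_ * _); exact: conjc_real.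
Qed.

Lemma evalp_revE N (a : Rn R N) (z : C) : z != 0 ->
  evalp_rev a z = z ^+ N * evalp a z^-1.
Proof.
move=> z0; rewrite /evalp mulr_sumr; apply: eq_bigr => j _.
rewrite mulrCA; congr (_ * _); have jN : (j <= N)%N by rewrite -ltnS.
have -> : z ^+ N = z ^+ j * z ^+ (N - j) by rewrite -exprD subnKC.
by rewrite exprVn mulfK ?expf_neq0.
Qed.

(** The difference of the squared moduli factors as (|z|^2 - 1) (1 - |r|^2). *)
Lemma norm_blaschke_le (r z : C) : `|r| <= 1 -> 1 <= `|z| ->
  `|1 - r * (z^*)%R| <= `|z - r|.
Proof.
move=> r1 z1; rewrite -(@ler_pXn2r _ 2)// ?nnegrE// !normCK -subr_ge0.
rewrite [X in 0 <= X](_ : _ = (`|z| ^+ 2 - 1) * (1 - `|r| ^+ 2)); last first.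
  by rewrite !normCK !rmorphB !rmorphM /= conjCK rmorph1; ring.
by rewrite mulr_ge0// subr_ge0 ?exprn_ege1// exprn_ile1.
Qed.

(** The coefficients are real, so z may be conjugated in the reversed polynomial, which then becomes
    the product of the 1 - r z^* over the roots r. It is compared factor by factor with the product
    of the z - r. *)
Lemma norm_evalp_rev_le N (a : Rn R N) (z : C) : Omega a -> 1 <= `|z| ->
  `|evalp_rev a z| <= `|evalp a z|.
Proof.
move=> /complex_poly_roots[rs [rsN rs1] aE] z1.
have z0 : z != 0 by rewrite -normr_gt0 (lt_le_trans _ z1).
rewrite -norm_conjC conj_evalp_rev evalp_revE ?conjC_eq0// -!horner_complex_poly aE.
rewrite -[N in _ ^+ N]rsN; elim: rs rs1 {rsN aE} => [|r rs IH] rs1.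
  by rewrite !big_nil !hornerC !mulr1.
rewrite !big_cons !hornerM !hornerXsubC exprS mulrACA normrM [leRHS]normrM.
apply: ler_pM => //; last by apply: IH => s srs; apply: rs1; rewrite in_cons srs orbT.
rewrite mulrBr divff ?conjC_eq0// [_ * r]mulrC.
by apply: norm_blaschke_le => //; apply: rs1; rewrite in_cons eqxx.
Qed.

(** Up to sign, P(0) is the product of the roots. This confines the last coordinate to [-1, 1]. *)
Lemma norm_tnth_max_le1 N (a : Rn R N.+1) : Omega a -> `|tnth a ord_max| <= 1.
Proof.
move=> /complex_poly_roots[rs [rsN rs1] aE].
have -> : tnth a ord_max = acoef a N.+1 by rewrite -acoefS.
have : evalp a 0 = (acoef a N.+1)%:C.
  rewrite /evalp big_ord_recr/= subnn expr0 mulr1 big1 ?add0r// => i _.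
  by rewrite expr0n subn_eq0 leqNgt ltn_ord mulr0.
rewrite -horner_complex_poly aE horner_prod => /(congr1 Num.norm).
rewrite normr_prod => aN.
rewrite -lecR -[X in X <= _](_ : `|(acoef a N.+1)%:C| = _); last first.
  by rewrite normc_def/= expr0n addr0 sqrtr_sqr.
rewrite -aN big_seq; apply: prodr_ile1 => r rrs.
by rewrite hornerXsubC sub0r normrN normr_ge0 rs1.
Qed.

Definition schur_lift n (k : R) (q : Rn R n) : Rn R n.+1 := nrcons (k, levinson k q).

(** The conventions for the indices 0 and n + 1 let one formula cover both ends: at j = 0 the second
    term vanishes, and at j = n + 1 only k q_0 = k remains. *)
Lemma acoef_schur_lift n (k : R) (q : Rn R n) j : (j <= n.+1)%N ->
  acoef (schur_lift k q) j = acoef q j + k * acoef q (n.+1 - j).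
Proof.
case: j => [_|j jn]; first by rewrite subn0 [acoef q n.+1]acoef_default// mulr0 addr0.
rewrite -[acoef _ _]/(acoef _ (Ordinal jn).+1) acoefS subSS.
have [jlt|] := ltnP j n.
  rewrite (@tnth_nrcons_widen _ _ _ (Ordinal jlt))//= tnth_mktuple.
  rewrite -[in acoef q j.+1]/(nat_of_ord (Ordinal jlt)) acoefS.
  have -> : (n - j = (rev_ord (Ordinal jlt)).+1)%N by rewrite /=; lia.
  by rewrite acoefS.
move=> nj; have {nj} jE : j = n by lia.
subst j; rewrite subnn acoef0 mulr1 [acoef q _]acoef_default// add0r.
by rewrite -[RHS](tnth_nrcons_max (k, levinson k q)); congr tnth; apply: val_inj.
Qed.

Lemma evalp_schur_lift n (k : R) (q : Rn R n) (z : C) :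
  evalp (schur_lift k q) z = z * evalp q z + k%:C * evalp_rev q z.
Proof.
rewrite /evalp (eq_bigr (fun j : 'I_n.+2 => (acoef q j)%:C * z ^+ (n.+1 - j) +
    k%:C * ((acoef q (n.+1 - j))%:C * z ^+ (n.+1 - j)))); last first.
  by move=> j _; rewrite acoef_schur_lift -1?ltnS// rmorphD rmorphM/= mulrDl mulrA.
rewrite big_split/= -mulr_sumr; congr (_ + _ * _).
  rewrite big_ord_recr/= acoef_default// rmorph0 mul0r addr0 mulr_sumr.
  by apply: eq_bigr => j _; rewrite mulrCA -exprS subSn// -ltnS.
rewrite (reindex_inj rev_ord_inj)/= big_ord_recr/= !subSS subnn subn0.
rewrite acoef_default// rmorph0 mul0r addr0.
by apply: eq_bigr => j _; rewrite subSS subKn// ltnW.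
Qed.

(** Reversal exchanges x Q and Q^* ; this companion identity serves the descent from P to Q. *)
Lemma evalp_rev_schur_lift n (k : R) (q : Rn R n) (z : C) :
  evalp_rev (schur_lift k q) z = evalp_rev q z + k%:C * (z * evalp q z).
Proof.
rewrite /evalp_rev (eq_bigr (fun j : 'I_n.+2 => (acoef q j)%:C * z ^+ j +
    k%:C * ((acoef q (n.+1 - j))%:C * z ^+ j))); last first.
  by move=> j _; rewrite acoef_schur_lift -1?ltnS// rmorphD rmorphM/= mulrDl mulrA.
rewrite big_split/= -mulr_sumr; congr (_ + _ * _).
  by rewrite big_ord_recr/= acoef_default// rmorph0 mul0r addr0.
rewrite (reindex_inj rev_ord_inj)/= big_ord_recr/= !subSS subnn subn0.
rewrite acoef_default// rmorph0 mul0r addr0 /evalp mulr_sumr.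
apply: eq_bigr => j _; rewrite subSS subKn ?(ltnW (ltn_ord _))//.
by rewrite mulrCA -exprS subSn// -ltnS.
Qed.

Lemma normCR (k : R) : `|k%:C| = `|k|%:C.
Proof. by rewrite normc_def/= expr0n addr0 sqrtr_sqr. Qed.

Lemma OmegaP N (a : Rn R N) :
  Omega a <-> forall z, 1 < `|z| -> evalp a z != 0.
Proof.
split=> [Oa z z1|Oa z].
  rewrite -horner_complex_poly; apply/negP => /Oa.
  by move=> /(lt_le_trans z1); rewrite ltxx.
rewrite /root horner_complex_poly => /eqP az.
have zr : `|z| \is Num.real by exact: normr_real.
rewrite real_leNgt// ?real1//; apply/negP => /Oa; by rewrite az eqxx.
Qed.

Lemma Omega_schur_lift n (k : R) (q : Rn R n) : `|k| < 1 ->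
  Omega (schur_lift k q) <-> Omega q.
Proof.
move=> k1; have k1C : `|k%:C| < 1 by rewrite normCR -[1]/((1 : R)%:C) ltcR.
split=> [Oa|Oq]; apply/OmegaP => z z1; apply/negP => /eqP.
(* At a zero z of Q, P(z) = k Q^*(z) and P^*(z) = Q^*(z), so |Q^*(z)| <= |k| |Q^*(z)|. Since P(z) is
   nonzero, so is Q^*(z), contradicting |k| < 1. *)
- have := norm_evalp_rev_le Oa (ltW z1).
  have : evalp (schur_lift k q) z != 0 by move/OmegaP : Oa => ->.
  rewrite evalp_rev_schur_lift evalp_schur_lift => /[swap] + + qz.
  rewrite qz !mulr0 add0r addr0 mulf_eq0 negb_or => + /andP[_ q0].
  rewrite normrM => /le_lt_trans.
  have kS : `|k%:C| * `|evalp_rev q z| < `|evalp_rev q z| by rewrite gtr_pMl ?normr_gt0.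
  by move=> /(_ _ kS); rewrite ltxx.
(* At a zero z of P, |z| |Q(z)| = |k| |Q^*(z)| <= |k| |Q(z)| with Q(z) nonzero, so |z| <= |k| <
   1. *)
- have := norm_evalp_rev_le Oq (ltW z1).
  have qz : evalp q z != 0 by move/OmegaP : Oq => ->.
  rewrite evalp_schur_lift => qle /eqP; rewrite addr_eq0 => /eqP/(congr1 Num.norm).
  rewrite normrN !normrM => zq.
  have : `|z| * `|evalp q z| <= `|k%:C| * `|evalp q z| by rewrite zq ler_wpM2l.
  rewrite ler_pM2r ?normr_gt0// => /(lt_le_trans z1)/lt_trans/(_ k1C).
  by rewrite ltxx.
Qed.

(** * Measurability of the region Omega *)

Lemma normC_Re (z : C) : `|z| = (complex.Re `|z|)%:C.
Proof. by rewrite RRe_real// normr_real. Qed.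

Lemma rat_complex_dense (z : C) (e : R) : 0 < e ->
  exists x y : rat, complex.Re `|(ratr x +i* ratr y) - z| < e.
Proof.
case: z => u v e0.
have near (w : R) : exists x : rat, `|ratr x - w| < e / 2.
  have /rat_in_itvoo[x] : w - e / 2 < w + e / 2 by lra.
  by rewrite in_itv/= => /andP[? ?]; exists x; rewrite ltr_norml; lra.
have [x xu] := near u; have [y yv] := near v; exists x, y.
rewrite normc_def/= -(@ltr_pXn2r _ 2)// ?nnegrE ?sqrtr_ge0 ?(ltW e0)//.
rewrite sqr_sqrtr ?addr_ge0 ?sqr_ge0// -[X in X ^+ 2 + _]/(_ - _).
move: xu yv; rewrite !ltr_norml => /andP[? ?] /andP[? ?]; nra.
Qed.

Lemma norm_horner_le (q : {poly C}) (z : C) (r : R) :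
  complex.Re `|z| <= r ->
  complex.Re `|q.[z]| <= \sum_(i < size q) complex.Re `|q`_i| * r ^+ i.
Proof.
move=> zr; rewrite -lecR -normC_Re horner_coef rmorph_sum/=.
apply: le_trans (ler_norm_sum _ _ _) _; apply: ler_sum => i _.
rewrite rmorphM rmorphXn /= -normC_Re normrM normrX ler_wpM2l//.
have zr' : `|z| <= r%:C by rewrite normC_Re lecR.
by apply: lerXn2r => //; rewrite nnegrE ?normr_ge0// (le_trans _ zr').
Qed.

(* Roots in the disc force |P(z)| >= (|z| - 1)^N for |z| > 1; rational points z
   suffice, which makes Omega a countable intersection of closed conditions. *)
Lemma not_OmegaP N (a : Rn R N) : ~ Omega a <->
  exists x y : rat, let z := ratr x +i* ratr y in
    1 < complex.Re `|z| /\ complex.Re `|evalp a z| < (complex.Re `|z| - 1) ^+ N.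
Proof.
split; last first.
  move=> [x [y]] /=; set z := _ +i* _ => -[z1 az] /complex_poly_roots[rs [rsN rs1] aE].
  suff : (`|z| - 1) ^+ N <= `|evalp a z|.
    rewrite (normC_Re z) (normC_Re (evalp a z)) -[1 in X in X -> _]/((1 : R)%:C).
    by rewrite -rmorphB -rmorphXn lecR leNgt az.
  rewrite -horner_complex_poly aE.
  rewrite -rsN; elim: rs rs1 {rsN aE} => [|r rs IH] rs1.
    by rewrite big_nil hornerC normr1.
  rewrite big_cons hornerM hornerXsubC exprS normrM.
  have r1 : `|r| <= 1 by apply: rs1; rewrite in_cons eqxx.
  have zC1 : 0 <= `|z| - 1.
    by rewrite subr_ge0 normC_Re -[1]/((1 : R)%:C) lecR ltW.
  apply: ler_pM => //; first by rewrite exprn_ge0.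
    by apply: le_trans (lerB_dist _ _); rewrite lerD2l lerN2.
  by apply: IH => s srs; apply: rs1; rewrite in_cons srs orbT.
move=> Oa.
have [r ar r1] : exists2 r, root (complex_poly a) r & 1 < complex.Re `|r|.
  apply: contrapT => h; apply: Oa => z az; rewrite normC_Re -[1]/((1 : R)%:C) lecR leNgt.
  by apply/negP => z1; apply: h; exists z.
have [q aE] := factor_theorem _ _ ar.
(* For |z - r| < e: e <= d keeps |z| - 1 above d, e <= 1 keeps z in the disc of radius |r| + 1 where
   B bounds the cofactor q, and the last term of the minimum gives B e < d ^ N. The summand 1 in B +
   1 covers B = 0. *)
pose d := (complex.Re `|r| - 1) / 2.
have d0 : 0 < d by rewrite /d; lra.
pose B := \sum_(i < size q) complex.Re `|q`_i| * (complex.Re `|r| + 1) ^+ i.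
have B0 : 0 <= B.
  apply: sumr_ge0 => i _; rewrite mulr_ge0 ?exprn_ge0//; last by lra.
  by rewrite -ler0c -normC_Re.
pose e := Num.min (Num.min 1 d) (d ^+ N / (B + 1)).
have e0 : 0 < e.
  by rewrite !lt_min ltr01 d0/= divr_gt0 ?exprn_gt0// ltr_wpDl.
have [e1 ed eB] : [/\ e <= 1, e <= d & e <= d ^+ N / (B + 1)].
  by rewrite /e !ge_min !lexx !orbT.
have [x [y xyr]] := rat_complex_dense r e0; exists x, y.
set z := ratr x +i* ratr y in xyr *.
rewrite -[let _ := _ in _]/(1 < complex.Re `|z| /\
  complex.Re `|evalp a z| < (complex.Re `|z| - 1) ^+ N).
have rz : complex.Re `|r| <= complex.Re `|z| + complex.Re `|z - r|.
  rewrite -lecR rmorphD/= -!normC_Re distrC.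
  by have := ler_normD z (r - z); rewrite [z + _]addrC subrK.
have zr : complex.Re `|z| <= complex.Re `|r| + complex.Re `|z - r|.
  rewrite -lecR rmorphD/= -!normC_Re.
  by have := ler_normD r (z - r); rewrite [r + _]addrC subrK.
have zd : d < complex.Re `|z| - 1 by rewrite /d in ed *; lra.
split; first by lra.
apply: (@lt_le_trans _ _ (d ^+ N)); last first.
  by apply: lerXn2r; rewrite ?nnegrE; lra.
have qz : complex.Re `|q.[z]| <= B by apply: norm_horner_le; lra.
have -> : complex.Re `|evalp a z| = complex.Re `|q.[z]| * complex.Re `|z - r|.
  apply: complexI; rewrite rmorphM/= -!normC_Re -normrM.
  by rewrite -horner_complex_poly aE hornerM hornerXsubC.
have q0 : 0 <= complex.Re `|q.[z]| by rewrite -ler0c -normC_Re.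
apply: (@le_lt_trans _ _ (B * e)).
  by apply: ler_pM => //; [rewrite -ler0c -normC_Re|exact: ltW].
apply: (@lt_le_trans _ _ ((B + 1) * e)); first by rewrite ltr_pM2r//; lra.
by rewrite mulrC -ler_pdivlMr// ltr_wpDl.
Qed.

Lemma ReC_sum (I : Type) (s : seq I) (F : I -> C) :
  complex.Re (\sum_(i <- s) F i) = \sum_(i <- s) complex.Re (F i).
Proof.
elim: s => [|i s IH]; first by rewrite !big_nil.
by rewrite !big_cons -IH; case: (F i) (bigop _ _ _) => [? ?] [? ?].
Qed.

Lemma ImC_sum (I : Type) (s : seq I) (F : I -> C) :
  complex.Im (\sum_(i <- s) F i) = \sum_(i <- s) complex.Im (F i).
Proof.
elim: s => [|i s IH]; first by rewrite !big_nil.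
by rewrite !big_cons -IH; case: (F i) (bigop _ _ _) => [? ?] [? ?].
Qed.

Lemma ReC_scale (x : R) (z : C) : complex.Re (x%:C * z) = x * complex.Re z.
Proof. by case: z => u v /=; rewrite mul0r subr0. Qed.

Lemma ImC_scale (x : R) (z : C) : complex.Im (x%:C * z) = x * complex.Im z.
Proof. by case: z => u v /=; rewrite mul0r addr0. Qed.

Lemma measurable_acoef N j : measurable_fun setT
  (fun a : Rn R N => acoef a j : measurableTypeR R).
Proof.
case: j => [|j]; first exact: measurable_cst.
have [jN|Nj] := ltnP j N.
  rewrite (_ : (fun _ => _) = fun a : Rn R N => tnth a (Ordinal jN)).
    exact: measurable_coord.
  by apply/funext => a; rewrite -acoefS.
rewrite (_ : (fun _ => _) = cst 0); first exact: measurable_cst.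
by apply/funext => a; rewrite acoef_default.
Qed.

Lemma measurable_Re_evalp N z :
  measurable_fun setT (fun a : Rn R N => complex.Re (evalp a z)).
Proof.
under eq_fun do rewrite ReC_sum.
apply: measurable_sum => j; under eq_fun do rewrite ReC_scale.
by apply: measurable_funM => //; exact: measurable_acoef.
Qed.

Lemma measurable_Im_evalp N z :
  measurable_fun setT (fun a : Rn R N => complex.Im (evalp a z)).
Proof.
under eq_fun do rewrite ImC_sum.
apply: measurable_sum => j; under eq_fun do rewrite ImC_scale.
by apply: measurable_funM => //; exact: measurable_acoef.
Qed.

Lemma measurable_Omega N : measurable (@Omega R N).
Proof.
rewrite -[X in measurable X]setCK; apply: measurableC.
rewrite (_ : ~` _ = \bigcup_(x : rat) \bigcup_(y : rat)
  [set a | let z := ratr x +i* ratr y in 1 < complex.Re `|z| /\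
    complex.Re `|evalp a z| < (complex.Re `|z| - 1) ^+ N]); last first.
  apply/seteqP; split => a.
    by move=> /not_OmegaP[x [y h]]; exists x => //; exists y.
  by move=> [x _ [y _ h]]; apply/not_OmegaP; exists x, y.
apply: bigcupT_measurable_rat => x; apply: bigcupT_measurable_rat => y.
set z := ratr x +i* ratr y; rewrite -/z.
have [z1|z1] := ltP 1 (complex.Re `|z|); last first.
  rewrite (_ : [set _ | _] = set0)//; apply/seteqP; split => a //.
  by move=> [z1' _]; move: z1; rewrite leNgt z1'.
(* Squaring removes the square root of the modulus and leaves a polynomial inequality in the
   coefficients. *)
pose S := [set a : Rn R N | ((complex.Re `|z| - 1) ^+ N) ^+ 2 <=
  complex.Re (evalp a z) ^+ 2 + complex.Im (evalp a z) ^+ 2].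
have mS : measurable S.
  rewrite -[S]setTI; apply: measurable_fun_le => //.
  by apply: measurable_funD; apply: measurable_funX;
    [exact: measurable_Re_evalp|exact: measurable_Im_evalp].
have z0 : 0 <= (complex.Re `|z| - 1) ^+ N by rewrite exprn_ge0// subr_ge0 ltW.
have SE a : (complex.Re `|evalp a z| < (complex.Re `|z| - 1) ^+ N) = ~~
    (((complex.Re `|z| - 1) ^+ N) ^+ 2 <=
      complex.Re (evalp a z) ^+ 2 + complex.Im (evalp a z) ^+ 2).
  rewrite -ltNge [`|evalp a z|]normc_def [complex.Re _]/=.
  rewrite -[LHS](@ltr_pXn2r _ 2) ?nnegrE ?sqrtr_ge0//.
  by rewrite sqr_sqrtr ?addr_ge0 ?sqr_ge0.
rewrite (_ : [set _ | _] = ~` S); first exact: measurableC.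
apply/seteqP; split => a; first by move=> [_]; rewrite SE => /negP.
by move=> h; split=> //; rewrite SE; apply/negP.
Qed.

End schur_cohn.

(** * Integration over the stability region *)

Lemma integrable_scale d (T : measurableType d) (R : realType)
    (mu : {measure set T -> \bar R}) (D : set T) (c : R) (g : T -> R) :
  measurable D -> mu.-integrable D (EFin \o g) ->
  mu.-integrable D (EFin \o (fun x => c * g x)).
Proof.
move=> mD ig; rewrite (_ : _ \o _ = fun x => (c%:E * (EFin \o g) x)%E).
  exact: integrableZl.
by apply/funext => x; rewrite /= EFinM.
Qed.

Section omega_recursion.
Variable R : realType.
Local Open Scope classical_set_scope.
Local Open Scope ereal_scope.
Local Notation leb := (@lebesgue_measure R).
Local Notation lebn n := (@lebesgue_measure_n R n).
Local Notation Om n := (@Omega R n).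

Lemma measurable_schur_lift n : measurable_fun setT
  (fun p : measurableTypeR R * Rn R n => schur_lift p.1 p.2).
Proof.
apply: (measurableT_comp (@measurable_nrcons R n)).
apply/measurable_fun_pairP; split => /=; first exact: measurable_fst.
apply: measurable_fun_tuple => i.
apply: measurable_funD; first exact: (measurableT_comp (measurable_coord _) measurable_snd).
apply: measurable_funM; first exact: measurable_fst.
exact: (measurableT_comp (measurable_coord _) measurable_snd).
Qed.

Lemma measurable_schur_lift1 n k : measurable_fun setT (@schur_lift R n k).
Proof.
exact: (measurableT_comp (@measurable_schur_lift n) (@measurable_pairl _ _ _ _ k)).
Qed.

Lemma levinson_det_gt0 n (k : R) : (`|k| < 1)%R -> (0 < levinson_det n k)%R.
Proof.
move=> k1; rewrite mulr_gt0// exprn_gt0//.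
  by rewrite subr_gt0 -real_normK ?num_real// expr_lt1.
by move: k1; rewrite ltr_norml => /andP[]; lra.
Qed.

Lemma levinson_det_le2 n (k : R) : (`|k| < 1)%R -> (levinson_det n k <= 2)%R.
Proof.
move=> k1; have := k1; rewrite ltr_norml => /andP[k1' k1''].
have c0 : (0 < 1 - k ^+ 2)%R by rewrite subr_gt0 -real_normK ?num_real// expr_lt1.
rewrite /levinson_det -[leRHS]mul1r; apply: ler_pM.
- by rewrite exprn_ge0// ltW.
- by rewrite exprn_ge0//; lra.
- by rewrite exprn_ile1 ?(ltW c0)// gerBl sqr_ge0.
- by case: (odd n); rewrite ?expr1 ?expr0; lra.
Qed.

Lemma measurable_levinson_det n (D : set R) : measurable_fun D (levinson_det n : R -> R).
Proof.
apply: measurable_funM; apply: measurable_funX.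
  by apply: measurable_funB => //; exact: measurable_funX.
exact: measurable_funD.
Qed.

Lemma measurable_integral_lift n (F : Rn R n.+1 -> \bar R) (D : set R) :
  measurable_fun setT F -> (forall a, 0 <= F a) ->
  measurable_fun D (fun k => \int[lebn n]_(q in Om n) F (schur_lift k q)).
Proof.
move=> mF F0; apply: measurable_funTS; under eq_fun do rewrite integral_mkcond.
pose G p := ((F \o (fun p => schur_lift p.1 p.2)) \_ (setT `*` Om n)) p.
have GE k q : ((fun q => F (schur_lift k q)) \_ (Om n)) q = G (k, q).
  rewrite /G /patch; case: ifPn => [/set_mem Oq|/negP nOq].
    by rewrite mem_set.
  by rewrite memNset// => -[_ Oq]; apply: nOq; exact: mem_set.
under eq_fun do under eq_integral do rewrite GE.
apply: (measurable_fun_fubini_tonelli_F G) => [|p]; last first.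
  by apply: erestrict_ge0 => ? _; exact: F0.
apply/(measurable_restrictT _ _).1.
  by apply: measurableX => //; exact: measurable_Omega.
by apply: measurable_funTS; exact: (measurableT_comp mF (@measurable_schur_lift n)).
Qed.

Lemma ge0_integral_Omega n (F : Rn R n.+1 -> \bar R) :
  measurable_fun setT F -> (forall a, 0 <= F a) ->
  \int[lebn n.+1]_(a in Om n.+1) F a =
  \int[leb]_(k in `](-1)%R, 1%R[) ((levinson_det n k)%:E *
    \int[lebn n]_(q in Om n) F (schur_lift k q)).
Proof.
move=> mF F0.
have mFO : measurable_fun setT (F \_ (Om n.+1)).
  apply/(measurable_restrictT _ _).1; first exact: measurable_Omega.
  exact: measurable_funTS.
have FO0 a : 0 <= (F \_ (Om n.+1)) a by apply: erestrict_ge0.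
rewrite integral_mkcond ge0_integral_nrcons//.
set G := fun k => \int[lebn n]_t _.
(* Inside the fibre the last coefficient k is fixed and the others are substituted by [levinson k];
   the domain becomes Omega of degree n by [Omega_schur_lift]. *)
have k1E k : (`|k| < 1)%R -> G k = (levinson_det n k)%:E *
    \int[lebn n]_(q in Om n) F (schur_lift k q).
  move=> k1; rewrite /G -(@ge0_integral_levinson R n k _ k1)//; last first.
    exact: (measurableT_comp mFO (measurableT_comp (@measurable_nrcons R _)
      (@measurable_pairl _ _ _ _ _))).
  congr (_ * _); rewrite [RHS]integral_mkcond; apply: eq_integral => q _.
  rewrite /patch; case: ifPn => [/set_mem|/negP] Oq.
    by rewrite mem_set//; apply/(@Omega_schur_lift R n k q k1).
  rewrite memNset// => Oq'; apply: Oq; apply: mem_set.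
  exact/(@Omega_schur_lift R n k q k1).
(* Fibres over |k| > 1 are empty by the bound on the constant coefficient; the two endpoints are
   then dropped as null. *)
transitivity (\int[leb]_(k in `[(-1)%R, 1%R]) G k).
  rewrite [RHS]integral_mkcond; apply: eq_integral => k _.
  rewrite [RHS]/patch; case: ifPn => // /negP kO.
  apply: integral0_eq => t _; rewrite /patch memNset// => /norm_tnth_max_le1.
  by rewrite tnth_nrcons_max ler_norml => k1; apply: kO; rewrite mem_set//= in_itv.
have mG : measurable_fun setT G.
  apply: (measurable_fun_fubini_tonelli_F (fun p => (F \_ (Om n.+1)) (nrcons p))) => //.
  exact: (measurableT_comp mFO (@measurable_nrcons R n)).
rewrite integral_itv_bndoo; last exact: measurable_funTS.
apply: eq_integral => k; rewrite inE/= in_itv/= => k1.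
by rewrite k1E// ltr_norml.
Qed.

(** The nonnegative formula is applied to the positive and the negative part. To subtract the
    results, each must be integrable in k; [part] gets this from the same formula, which identifies
    the integral over k with a finite one over Omega. *)
Lemma integral_Omega n (f : Rn R n.+1 -> R) :
  measurable_fun setT f -> (lebn n.+1).-integrable (Om n.+1) (EFin \o f) ->
  (forall k, (`|k| < 1)%R ->
    (lebn n).-integrable (Om n) (fun q => (f (schur_lift k q))%:E)) ->
  \int[lebn n.+1]_(a in Om n.+1) (f a)%:E =
  \int[leb]_(k in `](-1)%R, 1%R[) (levinson_det n k *
    Rintegral (lebn n) (Om n) (fun q => f (schur_lift k q)))%:E.
Proof.
move=> mf intf intq; rewrite integralE.
have mEf : measurable_fun setT (EFin \o f) by exact/measurable_EFinP.
have part (g : Rn R n.+1 -> \bar R) : (forall a, 0 <= g a) ->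
    measurable_fun setT g -> (lebn n.+1).-integrable (Om n.+1) g ->
    leb.-integrable `](-1)%R, 1%R[ (fun k => (levinson_det n k)%:E *
      \int[lebn n]_(q in Om n) g (schur_lift k q)).
  move=> g0 mg intg; apply/integrableP; split.
    apply: emeasurable_funM; last exact: measurable_integral_lift.
    by apply/measurable_EFinP; exact: measurable_levinson_det.
  apply: le_lt_trans (_ : _ <= \int[lebn n.+1]_(a in Om n.+1) g a) _.
    rewrite ge0_integral_Omega//; rewrite le_eqVlt; apply/orP; left; apply/eqP; apply: eq_integral.
    move=> k; rewrite inE/= in_itv/= -ltr_norml => k1.
    rewrite gee0_abs// mule_ge0//; first by rewrite lee_fin ltW// levinson_det_gt0.
    exact: integral_ge0.
  by rewrite integrable_lty//; exact: measurable_Omega.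
rewrite !ge0_integral_Omega//; [|exact: measurable_funeneg|exact: measurable_funepos].
rewrite -integralB//; last 2 first.
- apply: part => //; first exact: measurable_funepos.
  by apply: integrable_funepos => //; exact: measurable_Omega.
- apply: part => //; first exact: measurable_funeneg.
  by apply: integrable_funeneg => //; exact: measurable_Omega.
apply: eq_integral => k; rewrite inE/= in_itv/= -ltr_norml => k1.
have mO := @measurable_Omega R n.
have Ip : (lebn n).-integrable (Om n) (fun q => (EFin \o f)^\+ (schur_lift k q)).
  by have := integrable_funepos mO (intq _ k1); rewrite (funepos_comp (EFin \o f)).
have In : (lebn n).-integrable (Om n) (fun q => (EFin \o f)^\- (schur_lift k q)).
  by have := integrable_funeneg mO (intq _ k1); rewrite (funeneg_comp (EFin \o f)).
rewrite -muleBr ?integrable_fin_num//; last first.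
  by rewrite fin_num_adde_defr ?integrable_fin_num.
rewrite [RHS]EFinM fineK; last exact: integrable_fin_num (intq _ k1).
rewrite [in RHS]integralE; congr (_ * (_ - _)).
  by rewrite [in RHS](funepos_comp (EFin \o f) (schur_lift k)).
by rewrite [in RHS](funeneg_comp (EFin \o f) (schur_lift k)).
Qed.

Definition moment n j : R := Rintegral (lebn n) (Om n) (fun q => acoef q j).

Definition moments_finite n := forall j,
  (lebn n).-integrable (Om n) (fun q => (acoef q j)%:E).

Section weighted.
Variables (n : nat) (u : R -> R) (j : nat).
Hypotheses (mu : measurable_fun setT u).
Hypothesis iu : leb.-integrable `](-1)%R, 1%R[ (EFin \o u).
Hypothesis Mn : moments_finite n.
Hypothesis jn : (j <= n.+1)%N.

(** [u] will be the real or the imaginary part of |k|^(alpha-1), possibly unbounded near 0; this is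
    why it is assumed integrable on ]-1, 1[ and not bounded. *)
Let f (a : Rn R n.+1) : R := u (tnth a ord_max) * acoef a j.

Let f_lift k q :
  f (schur_lift k q) = (u k * (acoef q j + k * acoef q (n.+1 - j)))%R.
Proof. by rewrite /f acoef_schur_lift// tnth_nrcons_max. Qed.

Let mf : measurable_fun setT f.
Proof.
apply: measurable_funM; last exact: measurable_acoef.
exact: (measurableT_comp mu (@measurable_coord R n.+1 ord_max)).
Qed.

Let integrable_lift_coef k : (lebn n).-integrable (Om n)
  (fun q => (acoef q j + k * acoef q (n.+1 - j))%:E).
Proof.
have mO := @measurable_Omega R n.
under eq_fun do rewrite EFinD EFinM.
by apply: integrableD => //; apply: integrableZl => //.
Qed.

Let integrable_f_lift k :
  (lebn n).-integrable (Om n) (fun q => (f (schur_lift k q))%:E).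
Proof.
have mO := @measurable_Omega R n.
under eq_fun do rewrite f_lift EFinM.
exact: integrableZl.
Qed.

(** On each fibre the integrand is at most |u(k)| (|q_j| + |q_(n+1-j)|) and the Jacobian at most 2,
    so the finite moments one degree lower and the integral of |u| bound the whole. *)
Lemma integrable_weighted_coef : (lebn n.+1).-integrable (Om n.+1)
  (fun a => (u (tnth a ord_max) * acoef a j)%:E).
Proof.
have mO := @measurable_Omega R n.
have mEf : measurable_fun setT (EFin \o f) by exact/measurable_EFinP.
apply/integrableP; split; first exact: measurable_funTS.
rewrite -[fun a => _]/(fun a => `|(EFin \o f) a|).
rewrite (@ge0_integral_Omega n (fun a => `|(EFin \o f) a|))//; last first.
  exact: measurableT_comp.
pose A i := \int[lebn n]_(q in Om n) `|(acoef q i)%:E|.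
have A0 i : 0 <= A i by exact: integral_ge0.
have Aoo i : A i < +oo by have /integrableP[] := Mn i.
have mA i : measurable_fun (Om n) (fun q => `|(acoef q i)%:E|).
  apply: measurableT_comp => //; apply: measurable_funTS.
  by apply/measurable_EFinP; exact: measurable_acoef.
pose B := A j + A (n.+1 - j)%N.
have B0 : 0 <= B by exact: adde_ge0.
have Boo : B < +oo by exact: lte_add_pinfty.
have Bfin : B \is a fin_num by rewrite ge0_fin_numE.
apply: (@le_lt_trans _ _ (\int[leb]_(k in `](-1)%R, 1%R[) ((2 * B) * `|(u k)%:E|))).
  apply: ge0_le_integral => //.
  - move=> k; rewrite /= in_itv/= -ltr_norml => k1.
    rewrite mule_ge0//; last exact: integral_ge0.
    by rewrite lee_fin ltW// levinson_det_gt0.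
  - apply: emeasurable_funM; first by apply/measurable_EFinP; exact: measurable_levinson_det.
    by apply: (@measurable_integral_lift n (fun a => `|(EFin \o f) a|)) => //; exact: measurableT_comp.
  - apply: emeasurable_funM => //; apply: measurableT_comp => //.
    by apply/measurable_EFinP; exact: measurable_funTS.
  move=> k; rewrite /= in_itv/= -ltr_norml => k1.
  rewrite -muleA; apply: lee_pmul.
  - by rewrite lee_fin ltW// levinson_det_gt0.
  - exact: integral_ge0.
  - by rewrite lee_fin levinson_det_le2.
  rewrite muleC /B /A -ge0_integralD//.
  rewrite -ge0_integralZl//; last 2 first.
  - exact: emeasurable_funD.
  - by move=> q _; rewrite adde_ge0.
  apply: ge0_le_integral => //.
  - apply/measurable_EFinP/measurableT_comp => //; apply: measurable_funTS.
    exact: (measurableT_comp mf (@measurable_schur_lift1 n k)).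
  - by apply: emeasurable_funM => //; exact: emeasurable_funD.
  move=> q _; rewrite /= f_lift lee_fin normrM ler_wpM2l//.
  apply: le_trans (ler_normD _ _) _; rewrite lerD2l normrM.
  by rewrite ler_piMl// ltW.
rewrite ge0_integralZl//; last 2 first.
- by apply: measurableT_comp => //; apply/measurable_EFinP; exact: measurable_funTS.
- by rewrite mule_ge0.
have /integrableP[_ uoo] := iu.
by rewrite lte_mul_pinfty// ?mule_ge0// fin_numM.
Qed.

Lemma integrable_mul_bounded (p : R -> R) : measurable_fun setT p ->
  (forall k, (`|k| < 1)%R -> (`|p k| <= 2)%R) ->
  leb.-integrable `](-1)%R, 1%R[ (fun k => (u k * p k)%:E).
Proof.
move=> mp p2.
have i2 : leb.-integrable `](-1)%R, 1%R[ (fun k => 2 * (u k)%:E).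
  exact: integrableZl.
apply: (le_integrable _ _ _ i2) => //.
- by apply/measurable_EFinP/measurable_funTS; exact: measurable_funM.
- move=> k; rewrite /= in_itv/= -ltr_norml => k1.
  by rewrite lee_fin !normrM mulrC [Num.norm 2%R]ger0_norm// ler_wpM2r// p2.
Qed.

Lemma Rintegral_weighted_coef :
  Rintegral (lebn n.+1) (Om n.+1) (fun a => u (tnth a ord_max) * acoef a j)%R =
  (moment n j * Rintegral leb `](-1)%R, 1%R[ (fun k => u k * levinson_det n k) +
   moment n (n.+1 - j) *
     Rintegral leb `](-1)%R, 1%R[ (fun k => u k * (k * levinson_det n k)))%R.
Proof.
have mO := @measurable_Omega R n.
have i1 : leb.-integrable `](-1)%R, 1%R[ (fun k => (u k * levinson_det n k)%:E).
  apply: integrable_mul_bounded; first exact: measurable_levinson_det.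
  by move=> k k1; rewrite gtr0_norm ?levinson_det_gt0// levinson_det_le2.
have i2 : leb.-integrable `](-1)%R, 1%R[ (fun k => (u k * (k * levinson_det n k))%:E).
  apply: integrable_mul_bounded.
    by apply: measurable_funM => //; exact: measurable_levinson_det.
  move=> k k1; rewrite normrM -[leRHS]mul1r; apply: ler_pM => //; first exact: ltW.
  by rewrite gtr0_norm ?levinson_det_gt0// levinson_det_le2.
rewrite {1}/Rintegral (integral_Omega mf integrable_weighted_coef)//.
rewrite -!RintegralZl// -RintegralD//; last 2 first.
- exact: integrable_scale.
- exact: integrable_scale.
apply: eq_Rintegral => k _.
under eq_Rintegral do rewrite f_lift.
rewrite RintegralZl//; last exact: integrable_lift_coef.
rewrite RintegralD//; [|exact: Mn|exact: (integrable_scale _ mO (Mn _))].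
rewrite RintegralZl// /moment; first by ring.
exact: Mn.
Qed.

End weighted.

End omega_recursion.

(** * Power integrals with a complex exponent *)

Section improper_integrals.
Import numFieldNormedType.Exports.
Variable R : realType.
Local Open Scope classical_set_scope.
Local Notation leb := (@lebesgue_measure R).

Section antiderivative.
Variables f F : R -> R.
Hypothesis dF : forall x : R, 0 < x -> is_derive x 1 F (f x).
Hypothesis cf : forall x : R, 0 < x -> {for x, continuous f}.

Let FTC_pos (a : R) : 0 < a -> a < 1 ->
  (\int[leb]_(x in `[a, 1%R]) (f x)%:E = (F 1)%:E - (F a)%:E)%E.
Proof.
move=> a0 a1.
have cF x : 0 < x -> {for x, continuous F}.
  move=> x0; apply: differentiable_continuous; apply/derivable1_diffP.
  by apply: ex_derive; exact: dF.
apply: continuous_FTC2 => //.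
- apply: continuous_in_subspaceT => x; rewrite inE/= in_itv/= => /andP[ax _].
  by apply: cf; rewrite (lt_le_trans a0).
- split => [x||].
  + rewrite in_itv/= => /andP[ax _]; apply: ex_derive; apply: dF.
    exact: lt_trans ax.
  + by apply: cvg_at_right_filter; exact: cF.
  + by apply: cvg_at_left_filter; apply: cF.
- move=> x; rewrite in_itv/= => /andP[ax _].
  by rewrite derive1E (@derive_val _ _ _ _ _ _ _ (dF (lt_trans a0 ax))).
Qed.

(** The integrand may be singular at 0, so the fundamental theorem is applied on [x, 1] and gives I
    - F 1 + F x for the integral over [0, x]. As x tends to 0 from the right that integral vanishes
    by integrability, and F x by hypothesis. *)
Lemma Rintegral_antiderivative : F x @[x --> 0^'+] --> (0 : R) ->
  leb.-integrable `[0, 1] (EFin \o f) ->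
  \int[leb]_(x in `[0, 1]) f x = F 1.
Proof.
move=> F0 intf.
have /cvg_at_right_filter I0 := parameterized_integral_cvg_left ltr01 intf.
set I := Rintegral _ _ _.
suff : I - F 1 = 0 by lra.
apply: (cvg_unique _ _ I0); first exact: norm_hausdorff.
have FI : I - F 1 + F x @[x --> 0^'+] --> I - F 1.
  by rewrite -[X in _ --> X]addr0; apply: cvgD => //; exact: cvg_cst.
apply: cvg_trans FI.
apply: near_eq_cvg; near=> x.
have x0 : 0 < x by near: x; exact: nbhs_right_gt.
have x1 : x < 1 by near: x; exact: nbhs_right_lt.
have := @Rintegral_itvB R f (BLeft 0) (BRight 1) x intf.
rewrite !bnd_simp => /(_ (ltW x0) (ltW x1)).
rewrite Rintegral_itv_obnd_cbnd; last first.
  by apply: integrableS intf => //; apply: subset_itvr; rewrite bnd_simp ltW.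
rewrite [in X in _ = X]/Rintegral FTC_pos// -EFinB/= -/I /parameterized_integral.
lra.
Unshelve. all: by end_near. Qed.

(** Monotone convergence along the intervals [1/(n+2), 1], on which the integral is at most F 1. The
    shift by 2 keeps every left endpoint below 1. *)
Lemma ge0_integrable_antiderivative : (forall x, 0 < x -> 0 <= f x) ->
  (forall x, 0 < x -> 0 <= F x) -> measurable_fun setT f ->
  leb.-integrable `[0, 1] (EFin \o f).
Proof.
move=> f0 F0 mf.
have mEf : measurable_fun setT (EFin \o f) by exact/measurable_EFinP.
apply/integrableP; split; first exact: measurable_funTS.
rewrite -integral_itv_obnd_cbnd; last exact/measurable_funTS/measurableT_comp.
pose A n := `[(n.+2%:R)^-1 : R, 1]%classic.
have AE : `]0, 1] = \bigcup_n A n.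
  apply/seteqP; split => x.
    rewrite /= in_itv/= => /andP[x0 x1].
    exists (Num.truncn x^-1) => //; rewrite /A/= in_itv/= x1 andbT.
    rewrite invf_ple ?posrE//.
    by apply: le_trans (ltW (truncnS_gt _)) _; rewrite ler_nat.
  move=> [n _]; rewrite /A /= !in_itv/= => /andP[nx ->]; rewrite andbT.
  by apply: lt_le_trans nx; rewrite invr_gt0.
rewrite [X in (X < _)%E](_ : _ = \int[leb]_(x in `]0%R, 1%R]) (f x)%:E)%E; last first.
  apply: eq_integral.
  move=> x; rewrite inE/= in_itv/= => /andP[x0 _].
  by rewrite /= ger0_norm// f0.
have lim : (\int[leb]_(x in A i) (f x)%:E)%E @[i --> \oo] -->
    (\int[leb]_(x in \bigcup_i A i) (f x)%:E)%E.
  apply: ge0_nondecreasing_set_cvg_integral => //.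
  - apply/nondecreasing_seqP => n; rewrite subsetEset; apply: subset_itvr.
    by rewrite bnd_simp lef_pV2 ?posrE// ler_nat.
  - by move=> i; exact: measurable_itv.
  - by move=> i; exact: measurable_funTS.
  - move=> i x; rewrite /A /= in_itv/= => /andP[ix _].
    by rewrite lee_fin f0// (lt_le_trans _ ix).
rewrite AE; apply: (@le_lt_trans _ _ (F 1)%:E); last exact: ltry.
apply: (cvge_to_le lim); near=> n; rewrite /A FTC_pos//.
  by rewrite -EFinB lee_fin gerBl F0.
by rewrite invf_lt1// ltr1n.
Unshelve. all: by end_near. Qed.

End antiderivative.

Section oscillating_power.
Variable t : R.

(* The real part of (P - i Q) x^(s + i t); in the derivative (P - i Q) is multiplied
   by s + i t. *)
Definition osc_pow (s P Q x : R) : R :=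
  expR (s * ln x) * (P * cos (t * ln x) + Q * sin (t * ln x)).

Lemma is_derive_osc_pow (s P Q x : R) : 0 < x ->
  is_derive x 1 (osc_pow s P Q) (osc_pow (s - 1) (s * P + t * Q) (s * Q - t * P) x).
Proof.
move=> x0.
have dln (c : R) : is_derive x 1 (fun y : R => c * ln y) (c * x^-1).
  have := @is_deriveZ _ _ _ (@ln R) c x 1 _ (is_derive1_ln x0).
  by [].
have dE := @is_derive1_comp R expR (fun y => s * ln y) x _ _ (is_derive_expR _) (dln s).
have dC := @is_derive1_comp R cos (fun y => t * ln y) x _ _ (is_derive_cos _) (dln t).
have dS := @is_derive1_comp R sin (fun y => t * ln y) x _ _ (is_derive_sin _) (dln t).
have dPC := @is_deriveZ _ _ _ _ P x 1 _ dC.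
have dQS := @is_deriveZ _ _ _ _ Q x 1 _ dS.
have dPQ := @is_deriveD _ _ _ _ _ x 1 _ _ dPC dQS.
have := @is_deriveM _ _ _ _ x 1 _ _ dE dPQ.
move=> H; apply: (@is_derive_eq R R^o R^o (osc_pow s P Q) x 1 _ _ H).
rewrite /osc_pow mulrBl mul1r expRD expRN lnK ?posrE//= /GRing.scale/=.
rewrite -[(_ + _) x]/(P * cos (t * ln x) + Q * sin (t * ln x)).
field; exact: lt0r_neq0.
Qed.

Lemma measurable_osc_pow (s P Q : R) : measurable_fun setT (osc_pow s P Q).
Proof.
have ml (c : R) : measurable_fun setT (fun x : R => c * ln x).
  by apply: measurable_funM => //; exact: measurable_ln.
apply: measurable_funM; first by apply: (@measurableT_comp _ _ _ _ _ _ (@expR R)).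
apply: measurable_funD; apply: measurable_funM => //.
  by apply: (@measurableT_comp _ _ _ _ _ _ (@cos R)) => //; exact: (continuous_measurable_fun (@continuous_cos R)).
by apply: (@measurableT_comp _ _ _ _ _ _ (@sin R)) => //; exact: (continuous_measurable_fun (@continuous_sin R)).
Qed.

Lemma norm_osc_pow_le (s P Q x : R) :
  `|osc_pow s P Q x| <= expR (s * ln x) * (`|P| + `|Q|).
Proof.
rewrite normrM gtr0_norm ?expR_gt0// ler_wpM2l ?expR_ge0//.
apply: le_trans (ler_normD _ _) _; rewrite !normrM.
by apply: lerD; rewrite ler_piMr// ?cos_max ?sin_max.
Qed.

Lemma cvg0_osc_pow (s P Q : R) : 0 < s -> osc_pow s P Q x @[x --> 0^'+] --> (0 : R).
Proof.
move=> s0; apply/norm_cvg0P.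
have h : (powR x s * (`|P| + `|Q|)) @[x --> 0^'+] --> (0 : R).
  rewrite -[X in _ --> X](mul0r (`|P| + `|Q|)); apply: cvgMl; exact: powR_cvg0.
apply: (squeeze_cvgr _ (cvg_cst 0) h); near=> x.
rewrite normr_ge0/=; apply: le_trans (norm_osc_pow_le _ _ _ _) _.
have x0 : 0 < x by near: x; exact: nbhs_right_gt.
by rewrite /powR gt_eqF.
Unshelve. all: by end_near. Qed.

Lemma continuous_osc_pow (s P Q x : R) : 0 < x -> {for x, continuous (osc_pow s P Q)}.
Proof.
move=> x0; apply: differentiable_continuous; apply/derivable1_diffP.
by apply: ex_derive; exact: is_derive_osc_pow.
Qed.

End oscillating_power.

(** The function is the derivative of x^s / s, which is [osc_pow] with t = 0, P = 1/s and Q = 0. It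
    later dominates all oscillating powers with the same s. *)
Lemma integrable_expR_ln (s : R) : 0 < s ->
  leb.-integrable `[0, 1] (EFin \o (fun x => expR ((s - 1) * ln x))).
Proof.
move=> s0.
have E r P x : osc_pow 0 r P 0 x = expR (r * ln x) * P.
  by rewrite /osc_pow mul0r cos0 mulr1 mul0r addr0.
have fE : (fun x => expR ((s - 1) * ln x)) =
    osc_pow 0 (s - 1) (s * s^-1 + 0 * 0) (s * 0 - 0 * s^-1).
  apply/funext => x; rewrite !mul0r mulr0 subr0 addr0 divff ?gt_eqF// E.
  by rewrite mulr1.
rewrite fE; apply: (@ge0_integrable_antiderivative _ (osc_pow 0 s s^-1 0)).
- by move=> x x0; exact: is_derive_osc_pow.
- by move=> x x0; exact: continuous_osc_pow.
- by move=> x x0; rewrite -fE expR_ge0.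
- by move=> x x0; rewrite E mulr_ge0 ?expR_ge0// invr_ge0 ltW.
- exact: measurable_osc_pow.
Qed.

Lemma integrable_osc_pow (t s P Q : R) : 0 < s ->
  leb.-integrable `[0, 1] (EFin \o osc_pow t (s - 1) P Q).
Proof.
move=> s0.
have i1 : leb.-integrable `[0, 1]
    (EFin \o (fun x => (`|P| + `|Q|) * expR ((s - 1) * ln x))).
  by apply: integrable_scale => //; exact: integrable_expR_ln.
apply: (le_integrable _ _ _ i1) => //.
  by apply/measurable_funTS/measurable_EFinP; exact: measurable_osc_pow.
move=> x _; rewrite lee_fin; apply: le_trans (norm_osc_pow_le _ _ _ _ _) _.
by rewrite mulrC ler_norm.
Qed.

(** The integrand is parametrised by its antiderivative [osc_pow t s P Q], whose value at 1 is P;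
    division by s + i t is left to the choice of P and Q. *)
Lemma Rintegral_osc_pow (t s P Q : R) : 0 < s ->
  \int[leb]_(x in `[0, 1]) osc_pow t (s - 1) (s * P + t * Q) (s * Q - t * P) x = P.
Proof.
move=> s0; transitivity (osc_pow t s P Q 1); last first.
  by rewrite /osc_pow ln1 !mulr0 expR0 cos0 sin0 mul1r mulr1 mulr0 addr0.
apply: Rintegral_antiderivative.
- by move=> x x0; exact: is_derive_osc_pow.
- by move=> x x0; exact: continuous_osc_pow.
- exact: cvg0_osc_pow.
- exact: integrable_osc_pow.
Qed.

(** * Even and odd integrands on ]-1, 1[ *)

Section reflection.
Let oppR : measurableTypeR R -> measurableTypeR R := -%R.

Let measurable_oppR : measurable_fun setT oppR.
Proof. exact: measurable_funN. Qed.

Lemma ge0_integral_oppr (D : set R) (f : R -> \bar R) :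
  measurable D -> measurable_fun setT f -> (forall x, 0 <= f x)%E ->
  (\int[leb]_(x in -%R @^-1` D) f (- x)%R = \int[leb]_(x in D) f x)%E.
Proof.
move=> mD mf f0; transitivity (\int[pushforward leb oppR]_(x in D) f x)%E.
  by rewrite (ge0_integral_pushforward measurable_oppR)//; exact: measurable_funTS.
by apply: eq_measure_integral => A mA _; exact: lebesgue_measureN.
Qed.

Lemma integral_oppr (D : set R) (f : R -> \bar R) :
  measurable D -> measurable_fun setT f ->
  (\int[leb]_(x in -%R @^-1` D) f (- x)%R = \int[leb]_(x in D) f x)%E.
Proof.
move=> mD mf; rewrite integralE [RHS]integralE.
rewrite -!(ge0_integral_oppr mD)//; [|exact: measurable_funeneg|exact: measurable_funepos].
by rewrite (funepos_comp f (-%R)) (funeneg_comp f (-%R)).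
Qed.

Lemma integrable_oppr (D : set R) (f : R -> \bar R) :
  measurable D -> measurable_fun setT f ->
  leb.-integrable D f -> leb.-integrable (-%R @^-1` D) (fun x => f (- x)).
Proof.
move=> mD mf /integrableP[_ foo]; apply/integrableP; split.
  by apply: measurable_funTS; exact: (measurableT_comp mf measurable_oppR).
rewrite (ge0_integral_oppr (f := fun x => `|f x|%E))//.
exact: measurableT_comp.
Qed.

Let preimage_opp01 : -%R @^-1` `]0 : R, 1[ = `]-1, 0[%classic.
Proof.
by apply/seteqP; split => x /=; rewrite !in_itv/= => /andP[? ?]; apply/andP; split; lra.
Qed.

Let preimage_opp11 : -%R @^-1` `]-1 : R, 1[ = `]-1, 1[%classic.
Proof.
by apply/seteqP; split => x /=; rewrite !in_itv/= => /andP[? ?]; apply/andP; split; lra.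
Qed.

Let split11 : `]-1 : R, 1[%classic = `]-1, 0[ `|` `[0, 1[.
Proof. by rewrite -itv_bndbnd_setU// bnd_simp. Qed.

Let disj11 : [disjoint `]-1 : R, 0[%classic & `[0, 1[%classic].
Proof.
apply/disj_setPS => x [/=]; rewrite !in_itv/= => /andP[_ +] /andP[].
by move=> /lt_le_trans h0 /h0; rewrite ltxx.
Qed.

Section even.
Variable h : R -> R.
Hypothesis mh : measurable_fun setT h.
Hypothesis hN : forall x, h (- x) = h x.
Hypothesis ih : leb.-integrable `]0, 1[ (EFin \o h).

Let mEh : measurable_fun setT (EFin \o h). Proof. exact/measurable_EFinP. Qed.

Let ih10 : leb.-integrable `]-1, 0[ (EFin \o h).
Proof.
rewrite -preimage_opp01 (_ : EFin \o h = fun x => (EFin \o h) (- x)).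
  exact: integrable_oppr.
by apply/funext => x /=; rewrite hN.
Qed.

Let ih01 : leb.-integrable `[0, 1[ (EFin \o h).
Proof.
have /integrableP[_ hoo] := ih; apply/integrableP; split; first exact: measurable_funTS.
rewrite -integral_itv_obnd_cbnd//; apply: measurable_funTS.
exact: measurableT_comp.
Qed.

Lemma integrable_even : leb.-integrable `]-1, 1[ (EFin \o h).
Proof.
apply/integrableP; split; first exact: measurable_funTS.
rewrite split11 ge0_integral_setU//; last first.
  by apply: measurable_funTS; exact: measurableT_comp.
by have /integrableP[_ ?] := ih10; have /integrableP[_ ?] := ih01; rewrite lte_add_pinfty.
Qed.

Lemma Rintegral_even :
  \int[leb]_(x in `]-1, 1[) h x = 2 * \int[leb]_(x in `]0, 1[) h x.
Proof.
rewrite split11 Rintegral_setU//; last by rewrite -split11; exact: integrable_even.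
rewrite -[X in _ + X]Rintegral_itv_obnd_cbnd//.
rewrite mulr_natl mulr2n; congr (_ + _).
rewrite -preimage_opp01 /Rintegral -[in RHS]integral_oppr//.
by congr fine; apply: eq_integral => x _; rewrite hN.
Qed.

End even.

Lemma Rintegral_odd (h : R -> R) : measurable_fun setT h ->
  (forall x, h (- x) = - h x) -> leb.-integrable `]-1, 1[ (EFin \o h) ->
  \int[leb]_(x in `]-1, 1[) h x = 0.
Proof.
move=> mh hN ih; set I := Rintegral _ _ _.
have NI : - I = \int[leb]_(x in `]-1, 1[) h (- x).
  rewrite -[LHS]mulN1r -[LHS](RintegralZl (-1) _ ih)//; apply: eq_Rintegral => x _.
  by rewrite hN mulN1r.
suff : I = - I by lra.
rewrite NI /I /Rintegral -[in LHS]integral_oppr//; last exact/measurable_EFinP.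
by rewrite preimage_opp11.
Qed.

End reflection.

End improper_integrals.

(** * Linearity of the complex integral *)

Section complex_integral_theory.
Context d (T : measurableType d) (R : realType)
  (mu : {measure set T -> \bar R}) (D : set T).
Hypothesis mD : measurable D.
Implicit Types f g : T -> R[i].
Local Notation intble := (Cintegrable mu D).
Local Notation Cint := (Cintegral mu D).

Lemma eq_Cintegrable f g : {in D, f =1 g} -> intble f -> intble g.
Proof.
move=> fg [f1 f2]; split.
- by apply: eq_integrable f1 => // x xD; rewrite fg.
- by apply: eq_integrable f2 => // x xD; rewrite fg.
Qed.

Lemma eq_Cintegral f g : {in D, f =1 g} -> Cint f = Cint g.
Proof.
by move=> fg; congr (_ +i* _); apply: eq_Rintegral => x xD; rewrite fg.
Qed.

Lemma ReC_mul (x y : R[i]) : complex.Re (x * y) =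
  complex.Re x * complex.Re y - complex.Im x * complex.Im y.
Proof. by case: x y => [? ?] [? ?]. Qed.

Lemma ImC_mul (x y : R[i]) : complex.Im (x * y) =
  complex.Re x * complex.Im y + complex.Im x * complex.Re y.
Proof. by case: x y => [? ?] [? ?]. Qed.

Lemma ReC_add (x y : R[i]) : complex.Re (x + y) = complex.Re x + complex.Re y.
Proof. by case: x y => [? ?] [? ?]. Qed.

Lemma ImC_add (x y : R[i]) : complex.Im (x + y) = complex.Im x + complex.Im y.
Proof. by case: x y => [? ?] [? ?]. Qed.

Lemma complex_eqP (x y : R[i]) :
  complex.Re x = complex.Re y -> complex.Im x = complex.Im y -> x = y.
Proof. by case: x y => [? ?] [? ?] /= -> ->. Qed.

Lemma CintegrableZ (c : R[i]) f : intble f -> intble (fun x => c * f x).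
Proof.
move=> [f1 f2]; split.
- under eq_fun do rewrite ReC_mul EFinB.
  by apply: integrableB => //; exact: integrable_scale.
- under eq_fun do rewrite ImC_mul EFinD.
  by apply: integrableD => //; exact: integrable_scale.
Qed.

Lemma CintegralZ (c : R[i]) f : intble f -> Cint (fun x => c * f x) = c * Cint f.
Proof.
move=> [f1 f2]; apply: complex_eqP; rewrite /= ?ReC_mul ?ImC_mul /=.
- under eq_Rintegral do rewrite ReC_mul.
  by rewrite RintegralB//; [rewrite !RintegralZl|exact: integrable_scale..].
- under eq_Rintegral do rewrite ImC_mul.
  by rewrite RintegralD//; [rewrite !RintegralZl|exact: integrable_scale..].
Qed.

Lemma CintegrableD f g : intble f -> intble g -> intble (fun x => f x + g x).
Proof.
move=> [f1 f2] [g1 g2]; split.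
- by under eq_fun do rewrite ReC_add EFinD; exact: integrableD.
- by under eq_fun do rewrite ImC_add EFinD; exact: integrableD.
Qed.

Lemma CintegralD f g : intble f -> intble g ->
  Cint (fun x => f x + g x) = Cint f + Cint g.
Proof.
move=> [f1 f2] [g1 g2]; apply: complex_eqP; rewrite /= ?ReC_add ?ImC_add /=.
- by under eq_Rintegral do rewrite ReC_add; rewrite RintegralD.
- by under eq_Rintegral do rewrite ImC_add; rewrite RintegralD.
Qed.

Lemma Cintegrable0 : intble (fun=> 0).
Proof. by split; exact: integrable0. Qed.

Lemma Cintegral0 : Cint (fun=> 0) = 0.
Proof. by apply: complex_eqP; rewrite /= Rintegral_cst// mul0r. Qed.

Lemma Cintegrable_sum (I : Type) (s : seq I) (F : I -> T -> R[i]) :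
  (forall i, intble (F i)) -> intble (fun x => \sum_(i <- s) F i x).
Proof.
move=> iF; elim: s => [|i s IH].
  by under eq_fun do rewrite big_nil; exact: Cintegrable0.
by under eq_fun do rewrite big_cons; exact: CintegrableD.
Qed.

Lemma Cintegral_sum (I : Type) (s : seq I) (F : I -> T -> R[i]) :
  (forall i, intble (F i)) ->
  Cint (fun x => \sum_(i <- s) F i x) = \sum_(i <- s) Cint (F i).
Proof.
move=> iF; elim: s => [|i s IH].
  by under eq_fun do rewrite big_nil; rewrite big_nil Cintegral0.
under eq_fun do rewrite big_cons.
by rewrite CintegralD//; [rewrite IH big_cons|exact: Cintegrable_sum].
Qed.

End complex_integral_theory.

Lemma ReC_scaler (R : realType) (z : R[i]) (x : R) :
  complex.Re (z * x%:C) = complex.Re z * x.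
Proof. by rewrite mulrC ReC_scale mulrC. Qed.

Lemma ImC_scaler (R : realType) (z : R[i]) (x : R) :
  complex.Im (z * x%:C) = complex.Im z * x.
Proof. by rewrite mulrC ImC_scale mulrC. Qed.

(** * Beta integrals of |k|^(alpha-1) over ]-1, 1[ *)

Section cpow_integrals.
Variable R : realType.
Local Open Scope classical_set_scope.
Local Notation leb := (@lebesgue_measure R).
Local Notation C := R[i].
Local Notation B := (`](-1 : R), 1[%classic : set (measurableTypeR R)).
Implicit Types (alpha : C) (k : R).

Definition cpow_weight alpha k : C := cpow `|k| (alpha - 1).

Lemma Re_cpow_weight alpha k : k != 0 -> complex.Re (cpow_weight alpha k) =
  osc_pow (complex.Im alpha) (complex.Re alpha - 1) 1 0 `|k|.
Proof.
move=> k0; rewrite /cpow_weight /cpow normr_eq0 (negbTE k0) /cexp ReC_scale /osc_pow.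
case: alpha => s t /=; rewrite mul0r addr0 mul1r.
by congr (expR _ * cos _); ring.
Qed.

(** The imaginary part is the real part after multiplication by -i, that is P = 0 and Q = 1. *)
Lemma Im_cpow_weight alpha k : k != 0 -> complex.Im (cpow_weight alpha k) =
  osc_pow (complex.Im alpha) (complex.Re alpha - 1) 0 1 `|k|.
Proof.
move=> k0; rewrite /cpow_weight /cpow normr_eq0 (negbTE k0) /cexp ImC_scale /osc_pow.
case: alpha => s t /=; rewrite mul0r add0r mul1r.
by congr (expR _ * sin _); ring.
Qed.

Lemma cpow_weight0 alpha : cpow_weight alpha 0 = (alpha == 1)%:R.
Proof. by rewrite /cpow_weight /cpow normr0 eqxx subr_eq0. Qed.

Lemma cpow_weightN alpha k : cpow_weight alpha (- k) = cpow_weight alpha k.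
Proof. by rewrite /cpow_weight normrN. Qed.

Let measurable_off0 (g h : R -> R) : measurable_fun setT h ->
  (forall k, k != 0 -> g k = h `|k|) -> measurable_fun setT g.
Proof.
move=> mh gh; rewrite (_ : g = fun k => if k == 0 then g 0 else h `|k|); last first.
  by apply/funext => k; case: eqVneq => [->|/gh].
apply: measurable_fun_ifT => //; first exact: measurable_fun_eqr.
exact: (measurableT_comp mh (@normr_measurable R setT)).
Qed.

Lemma measurable_Re_cpow_weight alpha :
  measurable_fun setT (fun k => complex.Re (cpow_weight alpha k)).
Proof.
apply: measurable_off0 (@Re_cpow_weight alpha); exact: measurable_osc_pow.
Qed.

Lemma measurable_Im_cpow_weight alpha :
  measurable_fun setT (fun k => complex.Im (cpow_weight alpha k)).
Proof.
apply: measurable_off0 (@Im_cpow_weight alpha); exact: measurable_osc_pow.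
Qed.

Let even_part (g : R -> R) (s t P Q : R) : 0 < s -> measurable_fun setT g ->
  (forall k, g (- k) = g k) -> (forall k, k != 0 -> g k = osc_pow t (s - 1)
    (s * P + t * Q) (s * Q - t * P) `|k|) ->
  leb.-integrable B (EFin \o g) /\ Rintegral leb B g = 2 * P.
Proof.
move=> s0 mg gN gE.
have gE01 (k : R) : k \in (`]0, 1[%classic : set R) -> g k =
    osc_pow t (s - 1) (s * P + t * Q) (s * Q - t * P) k.
  by rewrite inE/= in_itv/= => /andP[k0 _]; rewrite gE ?gt_eqF// gtr0_norm.
have i01 := @integrable_osc_pow R t s (s * P + t * Q) (s * Q - t * P) s0.
have ig : leb.-integrable `]0, 1[ (EFin \o g).
  have : leb.-integrable `]0, 1[ (EFin \o osc_pow t (s - 1) (s * P + t * Q) (s * Q - t * P)).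
    by apply: integrableS i01 => //; exact: subset_itv_oo_cc.
  by apply: eq_integrable => // k k01; rewrite /= gE01.
split; first exact: integrable_even.
rewrite Rintegral_even//; congr (_ * _).
rewrite -[RHS](@Rintegral_osc_pow R t s P Q s0).
rewrite -Rintegral_itv_obnd_cbnd; last by apply: integrableS i01 => //; apply: subset_itvr; rewrite bnd_simp.
rewrite -Rintegral_itv_bndo_bndc; last first.
  by apply: integrableS i01 => //; exact: subset_itv_oo_cc.
by apply: eq_Rintegral => k k01; rewrite gE01.
Qed.

Lemma Cintegral_cpow_weight alpha : 0 < complex.Re alpha ->
  Cintegrable leb B (cpow_weight alpha) /\ Cintegral leb B (cpow_weight alpha) = 2 / alpha.
Proof.
have [s [t aE]] : exists s t, alpha = s +i* t by case: (alpha) => s t; exists s, t.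
move=> a0; rewrite aE /= in a0.
(* D = |alpha|^2. The coefficients below solve (P - i Q) alpha = 1 for the real part and (P - i Q)
   alpha = -i for the imaginary part. *)
pose D := s ^+ 2 + t ^+ 2.
have D0 : D != 0 by rewrite gt_eqF// ltr_pwDl ?sqr_ge0// exprn_gt0.
have [| |i1 e1] := @even_part (fun k => complex.Re (cpow_weight alpha k)) s t
  (s / D) (t / D) a0 (measurable_Re_cpow_weight alpha).
- by move=> k; rewrite cpow_weightN.
- by move=> k /Re_cpow_weight ->; rewrite aE /=; congr osc_pow; rewrite /D; field.
have [| |i2 e2] := @even_part (fun k => complex.Im (cpow_weight alpha k)) s t
  (- t / D) (s / D) a0 (measurable_Im_cpow_weight alpha).
- by move=> k; rewrite cpow_weightN.
- by move=> k /Im_cpow_weight ->; rewrite aE /=; congr osc_pow; rewrite /D; field.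
split; first by split.
have two : (2 : C) = (2 : R)%:C by rewrite rmorph_nat.
apply: complex_eqP; rewrite [LHS]/= ?e1 ?e2.
- by rewrite aE two ReC_scale.
- by rewrite aE two ImC_scale /= mulNr.
Qed.

(** Euler's B(alpha/2, r + 1), reached by substituting k^2, with its quotient of Gamma values
    expanded into a finite product. *)
Definition beta_factor (r : nat) alpha : C :=
  r`!%:R * 2 ^+ r.+1 / \prod_(i < r.+1) (alpha + (2 * i)%:R).

Lemma addrn_neq0 alpha (n : nat) : 0 < complex.Re alpha -> alpha + n%:R != 0.
Proof.
move=> a0; apply/eqP => /(congr1 (@complex.Re R)).
have -> : (n%:R : C) = (n%:R : R)%:C by rewrite rmorph_nat.
by rewrite ReC_add /= => /eqP; rewrite gt_eqF// ltr_wpDr.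
Qed.

Lemma Re_addn alpha (n : nat) : 0 < complex.Re alpha -> 0 < complex.Re (alpha + n%:R).
Proof.
have -> : (n%:R : C) = (n%:R : R)%:C by rewrite rmorph_nat.
by move=> a0; rewrite ReC_add /= ltr_wpDr.
Qed.

Lemma cexpD (x : R) (z : C) : cexp (x%:C + z) = (expR x)%:C * cexp z.
Proof.
by case: z => u v; rewrite /cexp /= add0r expRD rmorphM mulrA.
Qed.

Lemma sqr_cpow_weight alpha k : 0 < complex.Re alpha ->
  (k ^+ 2)%:C * cpow_weight alpha k = cpow_weight (alpha + 2) k.
Proof.
move=> a0; have [->|k0] := eqVneq k 0.
  (* At k = 0 the convention 0 ^ 0 = 1 would spoil the identity only for alpha = -1, which Re alpha
     > 0 excludes. *)
  rewrite expr0n mul0r cpow_weight0 -subr_eq0 -addrA.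
  by rewrite (_ : 2 - 1 = 1%:R); [rewrite (negbTE (addrn_neq0 _ a0))|ring].
rewrite /cpow_weight /cpow normr_eq0 (negbTE k0).
have -> : (alpha + 2 - 1) * (ln `|k|)%:C = (2 * ln `|k|)%:C + (alpha - 1) * (ln `|k|)%:C.
  by rewrite rmorphM rmorph_nat; ring.
rewrite cexpD; congr (_%:C * _).
by rewrite expRM_natl lnK ?posrE ?normr_gt0// real_normK ?num_real.
Qed.

Lemma Cintegrable_cpow_weight_poly alpha (p : R -> R) : 0 < complex.Re alpha ->
  measurable_fun setT p -> (forall k, `|k| < 1 -> `|p k| <= 2) ->
  Cintegrable leb B (fun k => cpow_weight alpha k * (p k)%:C).
Proof.
move=> a0 mp p2; have [[i1 i2] _] := Cintegral_cpow_weight a0; split.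
- have := integrable_mul_bounded (measurable_Re_cpow_weight alpha) i1 mp p2.
  by apply: eq_integrable => // k _; rewrite ReC_scaler.
- have := integrable_mul_bounded (measurable_Im_cpow_weight alpha) i2 mp p2.
  by apply: eq_integrable => // k _; rewrite ImC_scaler.
Qed.

Lemma norm_1Bsqr_le1 k r : `|k| < 1 -> `|(1 - k ^+ 2) ^+ r| <= 1.
Proof.
move=> k1; have c0 : 0 < 1 - k ^+ 2 by rewrite subr_gt0 -real_normK ?num_real// expr_lt1.
by rewrite normrX exprn_ile1// gtr0_norm// gerBl sqr_ge0.
Qed.

Lemma measurable_1Bsqr r : measurable_fun setT (fun k : R => (1 - k ^+ 2) ^+ r).
Proof. by apply: measurable_funX; apply: measurable_funB => //; exact: measurable_funX. Qed.

Lemma Cintegrable_cpow_weight_even alpha r : 0 < complex.Re alpha ->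
  Cintegrable leb B (fun k => cpow_weight alpha k * ((1 - k ^+ 2) ^+ r)%:C).
Proof.
move=> a0; apply: Cintegrable_cpow_weight_poly => //; first exact: measurable_1Bsqr.
by move=> k k1; apply: le_trans (norm_1Bsqr_le1 r k1) _; rewrite ler1n.
Qed.

Lemma Cintegrable_cpow_weight_odd alpha r : 0 < complex.Re alpha ->
  Cintegrable leb B (fun k => cpow_weight alpha k * (k * (1 - k ^+ 2) ^+ r)%:C).
Proof.
move=> a0; apply: Cintegrable_cpow_weight_poly => //.
  by apply: measurable_funM => //; exact: measurable_1Bsqr.
move=> k k1; rewrite normrM -[leRHS]mul1r; apply: ler_pM => //; first exact: ltW.
by apply: le_trans (norm_1Bsqr_le1 r k1) _; rewrite ler1n.
Qed.

(** Induction on r for all alpha at once: (1 - k^2)^(r+1) is (1 - k^2)^r minus k^2 (1 - k^2)^r, and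
    the factor k^2 turns alpha into alpha + 2. *)
Lemma Cintegral_cpow_weight_even alpha r : 0 < complex.Re alpha ->
  Cintegral leb B (fun k => cpow_weight alpha k * ((1 - k ^+ 2) ^+ r)%:C) =
  beta_factor r alpha.
Proof.
elim: r alpha => [|r IH] alpha a0.
  rewrite -[LHS](_ : Cintegral leb B (cpow_weight alpha) = _); last first.
    by apply: eq_Cintegral => k _; rewrite expr0 mulr1.
  have [_ ->] := Cintegral_cpow_weight a0.
  by rewrite /beta_factor big_ord1 muln0 addr0 expr1 fact0 mul1r.
have a2 : 0 < complex.Re (alpha + 2) by exact: Re_addn.
transitivity (Cintegral leb B (fun k => cpow_weight alpha k * ((1 - k ^+ 2) ^+ r)%:C +
    (-1) * (cpow_weight (alpha + 2) k * ((1 - k ^+ 2) ^+ r)%:C))).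
  apply: eq_Cintegral => k _; rewrite -sqr_cpow_weight// exprS rmorphM rmorphB rmorph1/=.
  ring.
have i1 := Cintegrable_cpow_weight_even r a0.
have i2 := Cintegrable_cpow_weight_even r a2.
rewrite CintegralD//; last exact: CintegrableZ.
rewrite CintegralZ// !IH// /beta_factor.
have P0 : \prod_(i < r) (alpha + 2 + (2 * i)%:R) != 0.
  by apply/prodf_neq0 => i _; exact: addrn_neq0.
have PE : \prod_(i < r) (alpha + 2 + (2 * i)%:R) = \prod_(i < r) (alpha + (2 * i.+1)%:R).
  by apply: eq_bigr => i _; rewrite -addrA -natrD mulnS.
have E1 : \prod_(i < r.+1) (alpha + (2 * i)%:R) =
    alpha * \prod_(i < r) (alpha + (2 * i.+1)%:R).
  by rewrite big_ord_recl/= muln0 addr0.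
have E2 : \prod_(i < r.+1) (alpha + 2 + (2 * i)%:R) =
    \prod_(i < r) (alpha + (2 * i.+1)%:R) * (alpha + (2 * r.+1)%:R).
  by rewrite big_ord_recr/= PE -[alpha + 2 + _]addrA -natrD mulnS.
have E3 : \prod_(i < r.+2) (alpha + (2 * i)%:R) =
    alpha * (\prod_(i < r) (alpha + (2 * i.+1)%:R) * (alpha + (2 * r.+1)%:R)).
  by rewrite big_ord_recl/= muln0 addr0 big_ord_recr.
have n1 : alpha != 0 by have := addrn_neq0 0 a0; rewrite addr0.
have n2 := addrn_neq0 (2 * r.+1) a0.
rewrite {}E1 {}E2 {}E3; rewrite {}PE in P0.
rewrite factS [in RHS]natrM [in RHS]exprS; move: n2; rewrite !natrM.
move: (r.+1%:R : C) (r`!%:R : C) (2 ^+ r.+1 : C) (\prod_(i < r) _) P0 => a b c p P0 n2.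
by field; rewrite n1 n2 P0.
Qed.

Lemma Cintegral_cpow_weight_odd alpha r : 0 < complex.Re alpha ->
  Cintegral leb B (fun k => cpow_weight alpha k * (k * (1 - k ^+ 2) ^+ r)%:C) = 0.
Proof.
move=> a0; have [i1 i2] := Cintegrable_cpow_weight_odd r a0.
have mp : measurable_fun setT (fun k : R => k * (1 - k ^+ 2) ^+ r).
  by apply: measurable_funM => //; exact: measurable_1Bsqr.
apply: complex_eqP; apply: Rintegral_odd => //.
- under eq_fun do rewrite ReC_scaler.
  by apply: measurable_funM => //; exact: measurable_Re_cpow_weight.
- by move=> k; rewrite cpow_weightN sqrrN mulNr rmorphN mulrN; case: (_ * _).
- under eq_fun do rewrite ImC_scaler.
  by apply: measurable_funM => //; exact: measurable_Im_cpow_weight.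
- by move=> k; rewrite cpow_weightN sqrrN mulNr rmorphN mulrN; case: (_ * _).
Qed.

End cpow_integrals.

(** * Closed forms of the coefficients *)

Section closed_forms.
Variable R : realType.
Local Notation C := R[i].
Local Open Scope nat_scope.

Lemma central_bin_recr i :
  2 * ((2 * i).+1 * 'C(2 * i, i)) = i.+1 * 'C(2 * i.+1, i.+1).
Proof.
have e1 := mul_bin_diag (2 * i).+1 i.
have e2 := mul_bin_down (2 * i).+1 i.+1.
have e3 := binS (2 * i).+1 i.
have -> : 2 * i.+1 = (2 * i).+2 by lia.
have e4 : 'C((2 * i).+1, i) = 'C((2 * i).+1, i.+1).
  by rewrite -bin_sub; [congr 'C(_, _); lia|lia].
rewrite e3 e4; rewrite /= in e1; lia.
Qed.

(** The factor 2^m m! is the product of the even numbers up to 2m. *)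
Lemma odd_fact_prod m :
  (\prod_(k < m.+1) (1 + 2 * k)) * 2 ^ m * m`! = (2 * m + 1)`!.
Proof.
elim: m => [|m IH]; first by rewrite big_ord1.
have -> : 2 * m.+1 + 1 = (2 * m + 1).+2 by lia.
rewrite big_ord_recr /= expnS !factS -IH.
by move: (\prod_(i < _) _) (2 ^ m) (m`!) => a b c; ring.
Qed.

Local Open Scope ring_scope.
Implicit Types (alpha : C) (m l : nat).

Definition odd_ratio m alpha : C :=
  \prod_(k < m) ((1 + 2 * k)%:R / (alpha + (2 * k)%:R)).

Lemma odd_ratio1 m : odd_ratio m 1 = 1.
Proof.
apply: big1 => k _; rewrite natrD divff// -natrD pnatr_eq0; lia.
Qed.

(** This is where D_N comes from: [Dfactor R m] is the beta integral at alpha = 1, where [odd_ratio]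
    is 1, and [odd_ratio] carries all the dependence on alpha. *)
Lemma beta_factorE m alpha :
  beta_factor m alpha = (Dfactor R m)%:C * odd_ratio m.+1 alpha.
Proof.
rewrite /odd_ratio prodf_div /beta_factor /Dfactor.
rewrite rmorphM fmorphV rmorphM !rmorphXn /= !rmorph_nat mulrA; congr (_ / _).
rewrite -natr_prod -odd_fact_prod !natrM natrX.
have f0 : (m`!%:R : C) != 0 by rewrite pnatr_eq0 -lt0n fact_gt0.
have p0 : ((\prod_(k < m.+1) (1 + 2 * k))%N%:R : C) != 0.
  by rewrite pnatr_eq0 -lt0n prodn_gt0.
have t0 : (2 ^+ m : C) != 0 by rewrite expf_neq0// pnatr_eq0.
have -> : (2 * m + 1 = m + m.+1)%N by lia.
rewrite exprD; field; rewrite f0 p0 t0.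
done.
Qed.

(** The two denominators share all factors but one: alpha on one side, alpha + 2(m+1) on the
    other. *)
Lemma beta_factor_shift m alpha : 0 < complex.Re alpha ->
  beta_factor m (alpha + 2) = beta_factor m alpha * (alpha / (alpha + (2 * m.+1)%:R)).
Proof.
move=> a0; rewrite /beta_factor [in LHS]big_ord_recr [in RHS]big_ord_recl /=.
rewrite muln0 addr0 -[alpha + 2 + (2 * m)%:R]addrA -natrD -mulnS.
have PE : \prod_(i < m) (alpha + 2 + (2 * i)%:R) = \prod_(i < m) (alpha + (2 * bump 0 i)%:R).
  by apply: eq_bigr => i _; rewrite -addrA -natrD -mulnS.
have P0 : \prod_(i < m) (alpha + (2 * bump 0 i)%:R) != 0.
  by apply/prodf_neq0 => i _; exact: addrn_neq0.
have n1 : alpha != 0 by have := addrn_neq0 0 a0; rewrite addr0.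
have n2 := addrn_neq0 (2 * m.+1) a0.
rewrite {}PE; move: (_ * _ : C) (\prod_(i < m) _) P0 ((2 * m.+1)%:R : C) n2 => x p P0 y n2.
by field; rewrite n1 n2 P0.
Qed.

Lemma DN_even m : DN R (2 * m) = \prod_(k < m) Dfactor R k ^+ 2.
Proof. by rewrite /DN mul2n odd_double doubleK mul1r. Qed.

Lemma DN_odd m : DN R (2 * m).+1 = DN R (2 * m) * Dfactor R m.
Proof. by rewrite DN_even /DN /= mul2n odd_double uphalf_double mulrC. Qed.

Lemma DN_even_recr m : DN R (2 * m.+1) = DN R (2 * m).+1 * Dfactor R m.
Proof. by rewrite DN_odd !DN_even big_ord_recr /= expr2 mulrA. Qed.

(** The inverse of the central binomial coefficient ['C(2 * m, m)]. *)
Definition fact_ratio m : C := m`!%:R ^+ 2 / (2 * m)`!%:R.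

Lemma fact_ratio_recr m :
  fact_ratio m.+1 = fact_ratio m * (m.+1%:R / (2 * (2 * m).+1%:R)).
Proof.
rewrite /fact_ratio; have -> : (2 * m.+1 = (2 * m).+2)%N by lia.
rewrite !factS !natrM.
have f0 : ((2 * m)`!%:R : C) != 0 by rewrite pnatr_eq0 -lt0n fact_gt0.
have -> : ((2 * m).+2%:R : C) = 2 * m.+1%:R by rewrite -natrM; congr (_%:R); lia.
have n1 : (m.+1%:R : C) != 0 by rewrite pnatr_eq0.
have n2 : ((2 * m).+1%:R : C) != 0 by rewrite pnatr_eq0.
move: (_`!%:R : C) (_`!%:R : C) f0 (m.+1%:R : C) n1 ((2 * m).+1%:R : C) n2 => a b.
by move=> f0 x n1 y n2; field; rewrite n1 n2 f0.
Qed.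

Definition bin_pair m l : C := 'C(2 * (m - l), m - l)%:R * 'C(2 * l, l)%:R.

(** The value sought for the integral of |a_N|^(alpha-1) a_(2l) with N = 2m. As a_(2l) multiplies
    T^(2(m-l)), the theorem's i is m - l here; [odd_coef] is the analogue for N = 2m + 1. *)
Definition even_coef m alpha l : C :=
  (DN R (2 * m))%:C * odd_ratio m alpha *
  (((2 * (m - l))%:R + alpha) / ((2 * m)%:R + alpha) * fact_ratio m * bin_pair m l).

Definition odd_coef m alpha l : C :=
  (DN R (2 * m).+1)%:C * odd_ratio m.+1 alpha *
  ((2 * (m - l) + 1)%:R / (2 * m).+1%:R * fact_ratio m * bin_pair m l).

(* [odd_coef m 1 l] rewritten through the central binomial recursion, so that it
   also vanishes at [l = m + 1]. *)
Definition odd_moment m l : C :=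
  (DN R (2 * m).+1)%:C *
  ((m.+1 - l)%:R / (2 * (2 * m).+1%:R) * fact_ratio m * bin_pair m.+1 l).

Lemma odd_coef1 m l : (l <= m)%N -> odd_coef m 1 l = odd_moment m l.
Proof.
move=> lm; rewrite /odd_coef odd_ratio1 mulr1 /odd_moment /bin_pair.
have := central_bin_recr (m - l); rewrite -subSn// => /(congr1 (fun n => n%:R : C)).
rewrite !natrM addn1 => e.
have n2 : ((2 * m).+1%:R : C) != 0 by rewrite pnatr_eq0.
congr (_ * _); apply: (@mulfI _ 2); first by rewrite pnatr_eq0.
move: ((2 * m).+1%:R : C) n2 ((2 * (m - l)).+1%:R : C) ('C(2 * (m - l), m - l)%:R : C)
  ((m - l).+1%:R : C) ('C(2 * (m - l).+1, (m - l).+1)%:R : C) e => y y0 u v p q e.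
transitivity (2 * (u * v) * y^-1 * fact_ratio m * 'C(2 * l, l)%:R : C); first by field.
by rewrite e; field.
Qed.

(** At alpha = 1 the inner fraction of [even_coef] is already that of [odd_coef]; the beta integral
    supplies the missing factor of D_N and the product in alpha. *)
Lemma odd_coef_recr m alpha l :
  even_coef m 1 l * beta_factor m alpha = odd_coef m alpha l.
Proof.
rewrite /even_coef /odd_coef odd_ratio1 mulr1 beta_factorE DN_odd.
rewrite [(DN R (2 * m) * Dfactor R m)%:C]rmorphM.
have -> : ((2 * (m - l) + 1)%:R : C) = (2 * (m - l))%:R + 1 by rewrite natrD.
have -> : ((2 * m).+1%:R : C) = (2 * m)%:R + 1 by rewrite natr1.
by ring.
Qed.

(** Both terms carry the same [bin_pair], by its symmetry in l and M - l, where M = m + 1. What is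
    left is (M - l) + l alpha / (alpha + 2M) = M (alpha + 2(M - l)) / (alpha + 2M), and M is
    absorbed by [fact_ratio_recr]. *)
Lemma even_coef_recr m alpha l : 0 < complex.Re alpha -> (l <= m.+1)%N ->
  odd_moment m l * beta_factor m alpha +
    odd_moment m (m.+1 - l) * beta_factor m (alpha + 2) = even_coef m.+1 alpha l.
Proof.
move=> a0 lm; rewrite beta_factor_shift// /odd_moment /bin_pair subKn//.
rewrite /even_coef fact_ratio_recr DN_even_recr /bin_pair.
rewrite [(DN R (2 * m).+1 * Dfactor R m)%:C]rmorphM.
rewrite -[_ * odd_ratio _ _]mulrA -beta_factorE.
have e : (m.+1%:R : C) = (m.+1 - l)%:R + l%:R by rewrite -natrD subnK.
have n2 : ((2 * m).+1%:R : C) != 0 by rewrite pnatr_eq0.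
have := addrn_neq0 (2 * m.+1) a0; rewrite [(2 * m.+1)%:R]natrM [(2 * (m.+1 - l))%:R]natrM e.
move: ((2 * m).+1%:R : C) n2 ((m.+1 - l)%:R : C) (l%:R : C) => y y0 u v n1.
by field; rewrite y0 addrC.
Qed.

End closed_forms.

(** * Moments and the theorem *)

Section moments.
Variable R : realType.
Local Open Scope classical_set_scope.
Local Notation leb := (@lebesgue_measure R).
Local Notation lebn n := (@lebesgue_measure_n R n).
Local Notation Om n := (@Omega R n).
Local Notation C := R[i].
Local Notation B := (`](-1 : R), 1[%classic : set (measurableTypeR R)).
Local Notation moment := (@moment R).
Local Notation moments_finite := (@moments_finite R).
Implicit Types alpha : C.

Definition weighted_coef n alpha j (a : Rn R n.+1) : C :=
  cpow_weight alpha (tnth a ord_max) * (acoef a j)%:C.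

Lemma Cintegrable_weighted_coef n alpha j : 0 < complex.Re alpha ->
  moments_finite n -> (j <= n.+1)%N ->
  Cintegrable (lebn n.+1) (Om n.+1) (weighted_coef alpha j).
Proof.
move=> a0 Mn jn; have [[i1 i2] _] := Cintegral_cpow_weight a0.
have mO := @measurable_Omega R n.+1.
split.
- have := integrable_weighted_coef (measurable_Re_cpow_weight alpha) i1 Mn jn.
  by apply: eq_integrable => // k _; rewrite ReC_scaler.
- have := integrable_weighted_coef (measurable_Im_cpow_weight alpha) i2 Mn jn.
  by apply: eq_integrable => // k _; rewrite ImC_scaler.
Qed.

(** The moments are real, so the recursion for real weights applies to the two parts of the weight
    separately. *)
Lemma Cintegral_weighted_coef n alpha j : 0 < complex.Re alpha ->
  moments_finite n -> (j <= n.+1)%N ->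
  Cintegral (lebn n.+1) (Om n.+1) (weighted_coef alpha j) =
  (moment n j)%:C * Cintegral leb B (fun k => cpow_weight alpha k * (levinson_det n k)%:C) +
  (moment n (n.+1 - j))%:C *
    Cintegral leb B (fun k => cpow_weight alpha k * (k * levinson_det n k)%:C).
Proof.
move=> a0 Mn jn; have [[i1 i2] _] := Cintegral_cpow_weight a0.
apply: complex_eqP; rewrite ?ReC_add ?ImC_add ?ReC_scale ?ImC_scale [LHS]/=.
- under eq_Rintegral do rewrite ReC_scaler.
  rewrite (Rintegral_weighted_coef (measurable_Re_cpow_weight alpha) i1 Mn jn).
  by congr (_ * _ + _ * _); apply: eq_Rintegral => k _; rewrite ReC_scaler.
- under eq_Rintegral do rewrite ImC_scaler.
  rewrite (Rintegral_weighted_coef (measurable_Im_cpow_weight alpha) i2 Mn jn).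
  by congr (_ * _ + _ * _); apply: eq_Rintegral => k _; rewrite ImC_scaler.
Qed.

Lemma levinson_det_even m (k : R) : levinson_det (2 * m) k = (1 - k ^+ 2) ^+ m.
Proof. by rewrite /levinson_det mul2n odd_double doubleK expr0 mulr1. Qed.

Lemma levinson_det_odd m (k : R) :
  levinson_det (2 * m).+1 k = (1 - k ^+ 2) ^+ m * (1 + k).
Proof. by rewrite /levinson_det /= mul2n odd_double uphalf_double expr1. Qed.

Lemma Cintegral_weighted_coef_odd m alpha j : 0 < complex.Re alpha ->
  moments_finite (2 * m) -> (j <= (2 * m).+1)%N ->
  Cintegral (lebn (2 * m).+1) (Om (2 * m).+1) (weighted_coef alpha j) =
  (moment (2 * m) j)%:C * beta_factor m alpha.
Proof.
move=> a0 Mn jn; rewrite Cintegral_weighted_coef//.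
under eq_Cintegral do rewrite levinson_det_even.
rewrite Cintegral_cpow_weight_even//.
under [X in _ + _ * X]eq_Cintegral do rewrite levinson_det_even.
by rewrite Cintegral_cpow_weight_odd// mulr0 addr0.
Qed.

(** The Jacobian is (1 - k^2)^m (1 + k). Of 1 + k the even part 1 survives with the first moment; of
    k (1 + k) the even part k^2 survives with the second, as a shift of alpha by 2. *)
Lemma Cintegral_weighted_coef_even m alpha j : 0 < complex.Re alpha ->
  moments_finite (2 * m).+1 -> (j <= (2 * m).+2)%N ->
  Cintegral (lebn (2 * m).+2) (Om (2 * m).+2) (weighted_coef alpha j) =
  (moment (2 * m).+1 j)%:C * beta_factor m alpha +
  (moment (2 * m).+1 ((2 * m).+2 - j))%:C * beta_factor m (alpha + 2).
Proof.
move=> a0 Mn jn; rewrite Cintegral_weighted_coef//.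
have mB : measurable B by exact: measurable_itv.
have a2 : 0 < complex.Re (alpha + 2) by exact: Re_addn.
have iE := Cintegrable_cpow_weight_even m a0.
have iO := Cintegrable_cpow_weight_odd m a0.
have iE2 := Cintegrable_cpow_weight_even m a2.
congr (_ * _ + _ * _).
- transitivity (Cintegral leb B (fun k => cpow_weight alpha k * ((1 - k ^+ 2) ^+ m)%:C +
    cpow_weight alpha k * (k * (1 - k ^+ 2) ^+ m)%:C)).
    apply: eq_Cintegral => k _; rewrite levinson_det_odd -mulrDr -rmorphD/=.
    by congr (_ * _%:C); ring.
  by rewrite CintegralD// Cintegral_cpow_weight_even// Cintegral_cpow_weight_odd// addr0.
- transitivity (Cintegral leb B (fun k => cpow_weight alpha k * (k * (1 - k ^+ 2) ^+ m)%:C +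
    cpow_weight (alpha + 2) k * ((1 - k ^+ 2) ^+ m)%:C)).
    apply: eq_Cintegral => k _; rewrite levinson_det_odd -sqr_cpow_weight//.
    rewrite [X in _ = _ + X]mulrAC [X in _ = _ + X]mulrC -rmorphM -mulrDr -rmorphD/=.
    by congr (_ * _%:C); ring.
  by rewrite CintegralD// Cintegral_cpow_weight_even// Cintegral_cpow_weight_odd// add0r.
Qed.

(** The convention 0 ^ 0 = 1 makes this hold at k = 0 too, so plain moments are weighted integrals
    at alpha = 1. *)
Lemma cpow_weight1 k : cpow_weight 1 k = 1 :> C.
Proof.
have [->|k0] := eqVneq k 0; first by rewrite cpow_weight0 eqxx.
rewrite /cpow_weight /cpow normr_eq0 (negbTE k0) subrr mul0r /cexp /= expR0 cos0 sin0.
by apply: complex_eqP; rewrite /= ?mul0r ?mul1r ?subr0 ?addr0.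
Qed.

Let Re1 : 0 < complex.Re (1 : C). Proof. by rewrite /= ltr01. Qed.

Lemma moment_Cintegral n j :
  (moment n.+1 j)%:C = Cintegral (lebn n.+1) (Om n.+1) (weighted_coef 1 j).
Proof.
apply: complex_eqP; rewrite /= /weighted_coef.
- by apply: eq_Rintegral => a _; rewrite cpow_weight1 mul1r.
- under eq_Rintegral do rewrite cpow_weight1 mul1r /=.
  by rewrite Rintegral_cst ?mul0r//; exact: measurable_Omega.
Qed.

Lemma moments_finite_recr n : moments_finite n -> moments_finite n.+1.
Proof.
move=> Mn j; have mO := @measurable_Omega R n.+1.
have [jn|nj] := leqP j n.+1.
  have [i1 _] := Cintegrable_weighted_coef Re1 Mn jn.
  by apply: eq_integrable i1 => // a _; rewrite /weighted_coef cpow_weight1 mul1r.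
under eq_fun do rewrite acoef_default//; exact: integrable0.
Qed.

Lemma moment_default n j : (n < j)%N -> moment n j = 0.
Proof.
move=> nj; rewrite /moment; under eq_Rintegral do rewrite acoef_default//.
by rewrite Rintegral_cst ?mul0r//; exact: measurable_Omega.
Qed.

Lemma Omega0 : Om 0 = setT.
Proof.
apply/seteqP; split=> // a _; apply/OmegaP => z _.
by rewrite /evalp big_ord1 acoef0 mul1r expr0 oner_eq0.
Qed.

Lemma moments_finite0 : moments_finite 0.
Proof.
case=> [|j]; last by under eq_fun do rewrite acoef_default//; exact: integrable0.
rewrite Omega0; apply/integrableP; split.
  by apply/measurable_EFinP; exact: measurable_acoef.
under eq_integral do rewrite acoef0 abse1.
by rewrite integral_cst//= diracE in_setT mul1e ltry.
Qed.

Lemma moment00 : moment 0 0 = 1.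
Proof.
rewrite /moment Omega0; under eq_Rintegral do rewrite acoef0.
by rewrite Rintegral_cst//= indicE in_setT mulr1.
Qed.

Definition even_moments m := [/\ moments_finite (2 * m),
  forall j, odd j -> moment (2 * m) j = 0 &
  forall l, (l <= m)%N -> (moment (2 * m) (2 * l))%:C = even_coef m 1 l].

(** The range includes l = m + 1, an index beyond the degree where both sides vanish: the next step
    pairs l with m + 1 - l and meets this value at both ends. *)
Definition odd_moments m := [/\ moments_finite (2 * m).+1,
  forall j, odd j -> moment (2 * m).+1 j = 0 &
  forall l, (l <= m.+1)%N -> (moment (2 * m).+1 (2 * l))%:C = odd_moment R m l].

Lemma odd_moments_of_even m : even_moments m -> odd_moments m.
Proof.
move=> [Mf Mo Me]; split; first exact: moments_finite_recr.
- move=> j oj; have [jn|nj] := leqP j (2 * m).+1; last exact: moment_default.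
  apply: complexI; rewrite moment_Cintegral Cintegral_weighted_coef_odd// Mo//.
  by rewrite mul0r.
- move=> l; rewrite leq_eqVlt => /predU1P[->|lm].
    rewrite moment_default; last by lia.
    by rewrite /odd_moment subnn !mul0r mulr0.
  rewrite moment_Cintegral Cintegral_weighted_coef_odd//; last by lia.
  by rewrite Me// odd_coef_recr odd_coef1.
Qed.

(** The indices j and 2m + 2 - j have the same parity, so the odd moments stay zero and the even
    ones combine by [even_coef_recr]. *)
Lemma even_moments_of_odd m : odd_moments m -> even_moments m.+1.
Proof.
move=> [Mf Mo Me]; have mE : (2 * m.+1 = (2 * m).+2)%N by lia.
rewrite /even_moments mE; split; first exact: moments_finite_recr.
- move=> j oj; have [jn|nj] := leqP j (2 * m).+2; last exact: moment_default.
  apply: complexI; rewrite moment_Cintegral Cintegral_weighted_coef_even//.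
  by rewrite !Mo ?mul0r ?addr0//; lia.
- move=> l lm; rewrite moment_Cintegral Cintegral_weighted_coef_even//; last by lia.
  have -> : ((2 * m).+2 - 2 * l = 2 * (m.+1 - l))%N by lia.
  by rewrite !Me//; [exact: even_coef_recr|lia].
Qed.

Lemma even_momentsP m : even_moments m.
Proof.
elim: m => [|m /odd_moments_of_even/even_moments_of_odd//].
split; first by rewrite muln0; exact: moments_finite0.
- by move=> [|j]// _; rewrite muln0 moment_default.
- move=> [|//] _; rewrite !muln0 moment00 /even_coef odd_ratio1 /fact_ratio /bin_pair.
  rewrite /DN /= big_ord0 !muln0 subnn fact0 bin0.
  by rewrite add0r expr1n divr1 !mulr1 rmorph1.
Qed.

Lemma odd_momentsP m : odd_moments m.
Proof. exact/odd_moments_of_even/even_momentsP. Qed.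

Lemma moments_finiteP n : moments_finite n.
Proof.
elim: n => [|n]; [exact: moments_finite0|exact: moments_finite_recr].
Qed.

Lemma integrandE n alpha (T : C) (a : Rn R n.+1) : integrand alpha T a =
  \sum_(j < n.+2) T ^+ (n.+1 - j) * weighted_coef alpha j a.
Proof.
rewrite /integrand; have -> : (monic_poly a).[0] = tnth a ord_max.
  rewrite /monic_poly hornerD hornerXn expr0n add0r horner_sum big_ord_recr/=.
  rewrite subnn expr0 hornerZ hornerC mulr1 big1 ?add0r// => i _.
  by rewrite hornerZ hornerXn expr0n subSS subn_eq0 leqNgt ltn_ord mulr0.
rewrite horner_complex_poly mulr_sumr.
by apply: eq_bigr => j _; rewrite /weighted_coef mulrA [RHS]mulrC.
Qed.

Lemma CN_weighted_coef n alpha (T : C) : 0 < complex.Re alpha ->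
  CN n.+1 alpha T = \sum_(j < n.+2) T ^+ (n.+1 - j) *
    Cintegral (lebn n.+1) (Om n.+1) (weighted_coef alpha j).
Proof.
move=> a0; have mO := @measurable_Omega R n.+1.
rewrite /CN; under eq_Cintegral do rewrite integrandE.
have iw (j : 'I_n.+2) : Cintegrable (lebn n.+1) (Om n.+1) (@weighted_coef n alpha j).
  by apply: Cintegrable_weighted_coef => //; [exact: moments_finiteP|rewrite -ltnS].
rewrite Cintegral_sum//; last by move=> j; exact: CintegrableZ.
by apply: eq_bigr => j _; rewrite CintegralZ.
Qed.

Lemma sum_even_indices (f : nat -> C) m :
  (forall j, odd j -> (j <= 2 * m)%N -> f j = 0) ->
  \sum_(j < (2 * m).+1) f j = \sum_(l < m.+1) f (2 * l)%N.
Proof.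
elim: m => [|m IH] f0; first by rewrite !big_ord1.
rewrite (_ : (2 * m.+1).+1 = (2 * m).+3)%N; last by lia.
rewrite [in RHS]big_ord_recr [in LHS]big_ord_recr/= [in LHS]big_ord_recr/= IH.
  by rewrite f0 ?addr0; [congr (_ + f _)|..]; lia.
by move=> j oj jm; apply: f0 => //; lia.
Qed.

End moments.

Theorem theorem1p8 (R : realType) (alpha : R[i])
    (halpha : 0 < complex.Re alpha) :
  (forall (N : nat) (T : R[i]), (0 < N)%N ->
     Cintegrable (@lebesgue_measure_n R N) (@Omega R N)
       (@integrand R N alpha T)) /\
  (forall (m : nat) (T : R[i]),
     CN (2 * m + 1) alpha T =
       (DN R (2 * m + 1))%:C *
       (\prod_(k < m.+1) ((1 + 2 * k)%:R / (alpha + (2 * k)%:R))) *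
       \sum_(i < m.+1)
         (2 * i + 1)%:R / (2 * m + 1)%:R *
         (m`!%:R ^+ 2 / (2 * m)`!%:R) *
         'C(2 * i, i)%:R * 'C(2 * m - 2 * i, m - i)%:R * T ^+ (2 * i + 1)) /\
  (forall (m : nat) (T : R[i]), (1 <= m)%N ->
     CN (2 * m) alpha T =
       (DN R (2 * m))%:C *
       (\prod_(k < m) ((1 + 2 * k)%:R / (alpha + (2 * k)%:R))) *
       \sum_(i < m.+1)
         ((2 * i)%:R + alpha) / ((2 * m)%:R + alpha) *
         (m`!%:R ^+ 2 / (2 * m)`!%:R) *
         'C(2 * i, i)%:R * 'C(2 * m - 2 * i, m - i)%:R * T ^+ (2 * i)).
Proof.
split; [|split].
- move=> [//|n] T _; have mO := @measurable_Omega R n.+1.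
  apply: (@eq_Cintegrable _ _ _ _ _ mO (fun a =>
    \sum_(j < n.+2) T ^+ (n.+1 - j) * weighted_coef alpha j a)).
    by move=> a _; rewrite integrandE.
  apply: Cintegrable_sum => // j; apply: CintegrableZ => //.
  by apply: Cintegrable_weighted_coef => //; [exact: moments_finiteP|rewrite -ltnS].
- move=> m T; rewrite addn1 CN_weighted_coef//.
  have [Mf Mo Me] := even_momentsP R m.
  pose K j : R[i] := T ^+ ((2 * m).+1 - j) *
    ((@moment R (2 * m) j)%:C * beta_factor m alpha).
  rewrite (eq_bigr (fun j : 'I_(2 * m).+2 => K j)); last first.
    by move=> j _; rewrite Cintegral_weighted_coef_odd// -ltnS.
  have K0 j : odd j -> K j = 0 by move=> oj; rewrite /K Mo// mul0r mulr0.
  (* The top index 2m + 1 is odd and its term vanishes, which leaves the range that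
     [sum_even_indices] expects. *)
  rewrite big_ord_recr/= K0 ?addr0; last by lia.
  rewrite sum_even_indices; last by move=> j /K0.
  (* Coefficients are indexed from the leading one, the theorem by powers of T; reversal sets l = m
     - i. *)
  rewrite (reindex_inj rev_ord_inj)/= mulr_sumr; apply: eq_bigr => i _.
  have im : (i <= m)%N by rewrite -ltnS.
  rewrite /K Me; last by lia.
  rewrite odd_coef_recr /odd_coef /odd_ratio /bin_pair /fact_ratio subSS subKn// mulnBr.
  have -> : ((2 * m).+1 - (2 * m - 2 * i) = 2 * i + 1)%N by lia.
  by ring.
- move=> [//|m] T _; have mE : (2 * m.+1 = (2 * m).+2)%N by lia.
  rewrite [CN _ _ _](_ : _ = CN (2 * m).+2 alpha T); last by rewrite -mE.
  rewrite CN_weighted_coef//.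
  have [Mf Mo Me] := odd_momentsP R m.
  pose K j : R[i] := T ^+ ((2 * m).+2 - j) *
    ((@moment R (2 * m).+1 j)%:C * beta_factor m alpha +
     (@moment R (2 * m).+1 ((2 * m).+2 - j))%:C * beta_factor m (alpha + 2)).
  rewrite (eq_bigr (fun j : 'I_(2 * m).+3 => K j)); last first.
    by move=> j _; rewrite Cintegral_weighted_coef_even// -ltnS.
  rewrite -mE sum_even_indices; last first.
    by move=> j oj jm; rewrite /K !Mo ?mul0r ?addr0 ?mulr0//; lia.
  rewrite (reindex_inj rev_ord_inj)/= mulr_sumr; apply: eq_bigr => i _.
  have im : (i <= m.+1)%N by rewrite -ltnS.
  rewrite /K -mE subSS -mulnBr subKn// !Me//; last by rewrite leq_subr.
  (* Here l = m + 1 - i, so the mirrored moment has index 2i. *)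
  have := even_coef_recr halpha (leq_subr i m.+1); rewrite subKn// => ->.
  rewrite /even_coef /odd_ratio /bin_pair /fact_ratio subKn//.
  by rewrite [(2 * (m.+1 - i))%N]mulnBr; ring.
Qed.
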